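(* Let $\Gamma\subseteq \mathrm{GL}_2(\mathbb F_q[T])$ be a subgroup containing $\Gamma(\mathfrak n)$ for some nonzero ideal $\mathfrak n$ of $\mathbb F_q[T]$. For all integers $k,\ell\geq 0$ and $m\in\mathbb Z$ there is a direct sum decomposition of $\mathbb C_\infty$-vector spaces \[ \widetilde W^{\,\leq \ell}_{k,m}(\Gamma)=\bigoplus_{i=0}^{\ell} W_{k-2i,m-i}(\Gamma)\,E^i , \] i.e. every $f\in \widetilde W^{\,\leq \ell}_{k,m}(\Gamma)$ can be written uniquely as $f=\sum_{i=0}^\ell g_iE^i$ with $g_i\in W_{k-2i,m-i}(\Gamma)$.
   Context: Let $q$ be a power of a prime $p$, $K=\mathbb F_q(T)$, $A=\mathbb F_q[T]$, $\infty=1/T$, $K_\infty$ the completion of $K$ at $\infty$ with norm $|a|_\infty=q^{\deg a}$, and $\mathbb C_\infty$ the completion of an algebraic closure of $K_\infty$. Let $\Omega=\mathbb P^1(\mathbb C_\infty)\setminus\mathbb P^1(K_\infty)$ be the Drinfeld upper half-plane (a rigid analytic space), with $\mathrm{GL}_2(K_\infty)$ acting by $\gamma z=\frac{az+b}{cz+d}$ for $\gamma=\begin{pmatrix}a&b\\c&d\end{pmatrix}$. For $k,m\in\mathbb Z$ and $f:\Omega\to\mathbb C_\infty$ put $(f|_{k,m}\gamma)(z)=(\det\gamma)^m(cz+d)^{-k}f(\gamma z)$. For a nonzero ideal $\mathfrak n$ of $A$, $\Gamma(\mathfrak n)=\{\gamma\in\mathrm{GL}_2(A):\gamma\equiv 1\bmod\mathfrak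 n\}$. Let $\mathcal O$ be the set of rigid analytic $f:\Omega\to\mathbb C_\infty$ such that $f(z+a)=f(z)$ for all $a$ in some nonzero ideal $I$ of $A$. For integers $k,\ell\ge 0$ and $m\in\mathbb Z$, a rigid analytic $f:\Omega\to\mathbb C_\infty$ is a (Drinfeld) quasi-modular function of weight $k$, type $m$ and depth $\ell$ for $\Gamma$ if there are $f_0,\dots,f_\ell\in\mathcal O$ with $f_\ell\ne0$ such that $(f|_{k,m}\gamma)(z)=\sum_{i=0}^\ell f_i(z)\left(\frac{c}{cz+d}\right)^i$ for all $z\in\Omega$ and all $\gamma=\begin{pmatrix}a&b\\c&d\end{pmatrix}\in\Gamma$; by convention $0$ is such a function of every weight and type, of depth $0$. $\widetilde W^{\,\ell}_{k,m}(\Gamma)$ denotes the set of these, $\widetilde W^{\,\leq\ell}_{k,m}(\Gamma)=\bigcup_{i\le\ell}\widetilde W^{\,i}_{k,m}(\Gamma)$ (a $\mathbb C_\infty$-vector space), and $W_{k,m}(\Gamma)=\widetilde W^{\,0}_{k,m}(\Gamma)$ (weakly modular functions). $E$ denotes the false Eisenstein series $E(z)=\tilde\pi^{-1}\sum_{a\in A\text{ monic}}\sum_{b\in A}\frac{a}{az+b}$, where $\tilde\pi$ is a fixed period of the Carlitz module; it satisfies $E(\gamma z)=(\det\gamma)^{-1}(cz+d)^2\big(E(z)-\frac{c}{\tilde\pi(cz+d)}\big)$ for all $\gamma\in\mathrm{GL}_2(A)$, so it is a quasi-modular function of weight 2, type 1, depth 1 for $\mathrm{GL}_2(A)$. *)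

(* Defs.v *)
From HB Require Import structures.
From mathcomp Require Import all_boot all_order all_algebra fraction finmap.
From mathcomp Require Import all_classical all_reals all_analysis.
From mathcomp Require Import showcase.summability.
From mathcomp Require Import ring lra.

Set Implicit Arguments.
Unset Strict Implicit.
Unset Printing Implicit Defensive.

Import Order.TTheory GRing.Theory Num.Theory.
Import numFieldNormedType.Exports.

Local Open Scope classical_set_scope.
Local Open Scope ring_scope.

(** * Nonarchimedean fields and the field C_oo *)

Record nonarch_abs (R : realType) (C : fieldType) (abs : C -> R) : Prop := {
  nonarch_ge0 : forall x, 0 <= abs x;
  nonarch_eq0 : forall x, abs x = 0 <-> x = 0;
  nonarch_mul : forall x y, abs (x * y) = abs x * abs y;
  nonarch_add : forall x y, abs (x + y) <= Num.max (abs x) (abs y)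
}.

Definition abs_closure (R : realType) (C : fieldType) (abs : C -> R)
    (S : set C) : set C :=
  [set x | forall e : R, 0 < e -> exists2 y, S y & abs (x - y) < e].

Definition abs_complete (R : realType) (C : fieldType) (abs : C -> R) : Prop :=
  forall u : nat -> C,
    (forall e : R, 0 < e -> exists N : nat,
      forall m n : nat, (N <= m)%N -> (N <= n)%N -> abs (u m - u n) < e) ->
    exists l : C, abs (u n - l) @[n --> \oo] --> (0 : R).

Definition algebraic_elements (C : fieldType) (S : set C) : set C :=
  [set x | exists2 p : {poly C}, p != 0 & (forall i, S p`_i) /\ root p x].

Definition algebraically_closed (C : fieldType) (S : set C) : Prop :=
  forall p : {poly C}, (forall i, S p`_i) -> (1 < size p)%N ->
    exists2 x, S x & root p x.

(** [C] is a completion of an algebraic closure of the completion of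
    K = Frac (F[T]) at 1/T.  Inside the complete field [C], the completion of K
    is the topological closure of K, and an algebraic closure of a subfield can
    only be its set of algebraic elements.  By multiplicativity, [Cinfty_deg]
    determines the absolute value on all of K. *)
Record is_Cinfty (R : realType) (F : finFieldType) (C : fieldType)
    (abs : C -> R) (iota : {rmorphism {fraction {poly F}} -> C}) : Prop := {
  Cinfty_nonarch : nonarch_abs abs;
  Cinfty_deg : forall a : {poly F}, a != 0 ->
    abs (iota (tofrac a)) = #|F|%:R ^+ (size a).-1;
  Cinfty_complete : abs_complete abs;
  Cinfty_closed :
    algebraically_closed
      (algebraic_elements (abs_closure abs (range iota)));
  Cinfty_dense :
    abs_closure abs (algebraic_elements (abs_closure abs (range iota))) = setT
}.

Record Cinfty (R : realType) (F : finFieldType) := {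
  Cfield :> fieldType;
  Cabs : Cfield -> R;
  Cemb : {rmorphism {fraction {poly F}} -> Cfield};
  CinftyP : is_Cinfty Cabs Cemb
}.

Arguments Cabs {R F C} : rename.
Arguments Cemb {R F} C : rename.

Definition Kinfty (R : realType) (F : finFieldType) (C : Cinfty R F) : set C :=
  abs_closure (@Cabs R F C) (range (Cemb C)).
Arguments Kinfty {R F} C _.

Definition embA (R : realType) (F : finFieldType) (C : Cinfty R F)
    (a : {poly F}) : C := Cemb C (tofrac a).
Arguments embA {R F} C a.

(** Limit along a filter; the value is 0 when there is no limit. *)
Definition Clim (R : realType) (F : finFieldType) (C : Cinfty R F) (T : Type)
    (G : set_system T) (u : T -> C) : C :=
  xget 0 [set l : C | Cabs (u t - l) @[t --> G] --> (0 : R)].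

(** Unordered sum over the elements of [I] satisfying [P]. *)
Definition Csum (R : realType) (F : finFieldType) (C : Cinfty R F)
    (I : choiceType) (P : pred I) (u : I -> C) : C :=
  Clim totally (fun S : {fset I} => \sum_(i <- S | P i) u i).

(** * The Drinfeld upper half-plane *)

(** The point at infinity of P^1(C_oo) is K_oo-rational, hence not in Omega. *)
Definition Omega (R : realType) (F : finFieldType) (C : Cinfty R F) : set C :=
  ~` Kinfty C.
Arguments Omega {R F} C _.

Definition toC (R : realType) (F : finFieldType) (C : Cinfty R F)
    (z : Omega C) : C := val z.

Definition autfactor (R : realType) (F : finFieldType) (C : Cinfty R F)
    (M : 'M[C]_2) (z : Omega C) : C := M 1 0 * toC z + M 1 1.

(** The default value [z] of [insubd] is never used for M in GL_2(K_oo), nor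
    is the denominator ever zero: see [autfactor_neq0] and [mobiusE]. *)
Definition mobius (R : realType) (F : finFieldType) (C : Cinfty R F)
    (M : 'M[C]_2) (z : Omega C) : Omega C :=
  insubd z ((M 0 0 * toC z + M 0 1) / autfactor M z).

(** The standard exhausting admissible covering of Omega by affinoids:
    |z| <= q^n and the distance of z to K_oo is at least q^-n. *)
Definition affinoid (R : realType) (F : finFieldType) (C : Cinfty R F)
    (n : nat) : set (Omega C) :=
  [set z | Cabs (toC z) <= #|F|%:R ^+ n /\
    forall x : C, Kinfty C x -> #|F|%:R ^- n <= Cabs (toC z - x)].
Arguments affinoid {R F} C n _.

(** On each affinoid, a uniform limit of rational functions without poles
    there. *)
Definition rigid_analytic (R : realType) (F : finFieldType) (C : Cinfty R F)
    (f : Omega C -> C) : Prop :=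
  forall (n : nat) (e : R), 0 < e -> exists p r : {poly C},
    forall z, affinoid C n z ->
      r.[toC z] != 0 /\ Cabs (f z - p.[toC z] / r.[toC z]) < e.

(** * Ideals of A and congruence subgroups of GL_2(A) *)

Definition nonzero_ideal (A : comNzRingType) (I : set A) : Prop :=
  [/\ I 0, forall x y, I x -> I y -> I (x + y),
      forall a x, I x -> I (a * x) & exists2 x, I x & x != 0].

Definition GL2_subgroup (A : comUnitRingType) (G : set 'M[A]_2) : Prop :=
  [/\ G `<=` [set g | g \in unitmx], G 1%:M,
      forall g h, G g -> G h -> G (g *m h) & forall g, G g -> G (invmx g)].

Definition principal_congruence (A : comUnitRingType) (I : set A) :
    set 'M[A]_2 :=
  [set g | g \in unitmx /\ forall i j, I (g i j - (1%:M : 'M[A]_2) i j)].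

(** * Quasi-modular functions *)

Definition slash (R : realType) (F : finFieldType) (C : Cinfty R F)
    (k m : int) (f : Omega C -> C) (g : 'M[{poly F}]_2) (z : Omega C) : C :=
  let M := map_mx (embA C) g in
  (\det M) ^ m * (autfactor M z) ^ (- k) * f (mobius M z).

Definition periodic_analytic (R : realType) (F : finFieldType)
    (C : Cinfty R F) : set (Omega C -> C) :=
  [set f | rigid_analytic f /\
    exists2 I : set {poly F}, nonzero_ideal I &
      forall a, I a -> forall z w : Omega C,
        toC w = toC z + embA C a -> f w = f z].
Arguments periodic_analytic {R F} C _.

Definition quasi_modular (R : realType) (F : finFieldType) (C : Cinfty R F)
    (G : set 'M[{poly F}]_2) (k m : int) (l : nat) : set (Omega C -> C) :=
  [set f | rigid_analytic f /\
    ((exists fs : 'I_l.+1 -> Omega C -> C,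
       [/\ forall i, periodic_analytic C (fs i),
           fs ord_max <> (fun=> 0) &
           forall g, G g -> forall z,
             slash k m f g z =
             \sum_(i < l.+1) fs i z *
               (embA C (g 1 0) / autfactor (map_mx (embA C) g) z) ^+ i])
     \/ (l = 0%N /\ f = (fun=> 0)))].
Arguments quasi_modular {R F} C G k m l _.

Definition quasi_modular_le (R : realType) (F : finFieldType)
    (C : Cinfty R F) (G : set 'M[{poly F}]_2) (k m : int) (l : nat) :
    set (Omega C -> C) :=
  [set f | exists2 i : nat, (i <= l)%N & quasi_modular C G k m i f].
Arguments quasi_modular_le {R F} C G k m l _.

Definition weakly_modular (R : realType) (F : finFieldType) (C : Cinfty R F)
    (G : set 'M[{poly F}]_2) (k m : int) : set (Omega C -> C) :=
  quasi_modular C G k m 0.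
Arguments weakly_modular {R F} C G k m _.

Definition linear_subspace (X : Type) (K : fieldType) (W : set (X -> K)) :
    Prop :=
  W (fun=> 0) /\
  forall (a : K) f g, W f -> W g -> W (fun x => a * f x + g x).

(** * The Carlitz period and the false Eisenstein series *)

Definition carlitz_D (F : finFieldType) (i : nat) : {poly F} :=
  \prod_(j < i) ('X ^+ (#|F| ^ i) - 'X ^+ (#|F| ^ j)).

Definition carlitz_exp (R : realType) (F : finFieldType) (C : Cinfty R F)
    (z : C) : C :=
  Clim \oo
    (fun n : nat => \sum_(i < n) z ^+ (#|F| ^ i) / embA C (carlitz_D F i)).

(** [w] generates the period lattice of the Carlitz module. *)
Definition carlitz_period (R : realType) (F : finFieldType) (C : Cinfty R F)
    (w : C) : Prop :=
  w != 0 /\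
  forall z : C, carlitz_exp z = 0 <-> exists a : {poly F}, z = w * embA C a.

Definition false_eisenstein (R : realType) (F : finFieldType)
    (C : Cinfty R F) (w : C) (z : Omega C) : C :=
  w^-1 * Csum (fun a : {poly F} => a \is monic) (fun a =>
    Csum predT (fun b : {poly F} =>
      embA C a / (embA C a * toC z + embA C b))).

(** * Well-definedness of the action of GL_2(K_oo) on Omega *)

Section Action.
Context (R : realType) (F : finFieldType) (C : Cinfty R F).
Local Notation abs := (@Cabs R F C).
Local Notation K := (@Kinfty R F C).

Let absP : nonarch_abs abs := Cinfty_nonarch (CinftyP C).
Let absM := nonarch_mul absP.
Let abs_ge0 := nonarch_ge0 absP.

Lemma Cabs0 : abs 0 = 0.
Proof. by apply/(nonarch_eq0 absP). Qed.

Lemma Cabs_eq0 x : (abs x == 0) = (x == 0).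
Proof. by apply/eqP/eqP => /(nonarch_eq0 absP). Qed.

Lemma Cabs_gt0 x : (0 < abs x) = (x != 0).
Proof. by rewrite lt_def abs_ge0 andbT Cabs_eq0. Qed.

Lemma Cabs1 : abs 1 = 1.
Proof.
have n0 : abs 1 != 0 by rewrite Cabs_eq0 oner_eq0.
by apply: (mulfI n0); rewrite -absM !mulr1.
Qed.

Lemma CabsN x : abs (- x) = abs x.
Proof.
have h : abs (-1) = 1.
  apply/eqP; rewrite -(eqrXn2 (n := 2)) // ?ler01 //.
  by rewrite expr2 -absM mulrNN mulr1 Cabs1 expr1n.
by rewrite -mulN1r absM h mul1r.
Qed.

Lemma CabsD_lt x y e : abs x < e -> abs y < e -> abs (x + y) < e.
Proof.
by move=> hx hy; apply: le_lt_trans (nonarch_add absP x y) _; rewrite gt_max hx.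
Qed.

Lemma CabsV x : abs x^-1 = (abs x)^-1.
Proof.
have [->|n0] := eqVneq x 0; first by rewrite invr0 Cabs0 invr0.
have n1 : abs x != 0 by rewrite Cabs_eq0.
by apply: (mulfI n1); rewrite -absM !divff // Cabs1.
Qed.

Lemma Kinfty_emb y : K (Cemb C y).
Proof. by move=> e e0; exists (Cemb C y); [exists y|rewrite subrr Cabs0]. Qed.

Lemma KinftyD x y : K x -> K y -> K (x + y).
Proof.
move=> hx hy e e0; have [_ [a _ <-] ha] := hx e e0.
have [_ [b _ <-] hb] := hy e e0.
exists (Cemb C (a + b)); first by exists (a + b).
by rewrite rmorphD opprD addrACA; apply: CabsD_lt.
Qed.

Lemma KinftyM x y : K x -> K y -> K (x * y).
Proof.
move=> hx hy e e0; have y1 : 0 < abs y + 1 by rewrite ltr_wpDl.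
have [_ [a _ <-] ha] := hx (e / (abs y + 1)) (divr_gt0 e0 y1).
have a1 : 0 < abs (Cemb C a) + 1 by rewrite ltr_wpDl.
have [_ [b _ <-] hb] := hy (e / (abs (Cemb C a) + 1)) (divr_gt0 e0 a1).
exists (Cemb C (a * b)); first by exists (a * b).
rewrite rmorphM (_ : _ - _ =
  (x - Cemb C a) * y + Cemb C a * (y - Cemb C b)); last by ring.
apply: CabsD_lt; rewrite absM.
  move: ha; rewrite ltr_pdivlMr //; apply: le_lt_trans.
  by rewrite ler_wpM2l // lerDl.
move: hb; rewrite ltr_pdivlMr // mulrC; apply: le_lt_trans.
by rewrite ler_wpM2r // lerDl.
Qed.

Lemma KinftyN x : K x -> K (- x).
Proof.
move=> hx; rewrite -mulN1r -(rmorph1 (Cemb C)) -rmorphN.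
exact: KinftyM (Kinfty_emb _) hx.
Qed.

Lemma KinftyV x : K x -> K x^-1.
Proof.
move=> hx; have [->|n0] := eqVneq x 0.
  by rewrite invr0 -(rmorph0 (Cemb C)); exact: Kinfty_emb.
move=> e e0; have x0 : 0 < abs x by rewrite Cabs_gt0.
have e1 : 0 < Num.min (abs x) (e * (abs x * abs x)).
  by rewrite lt_min x0 !mulr_gt0.
have [_ [a _ <-]] := hx _ e1; rewrite lt_min => /andP[h1 h2].
have ax : abs x <= abs (Cemb C a).
  rewrite leNgt; apply/negP => h3.
  suff : abs x < abs x by rewrite ltxx.
  by rewrite -{1}(subrK (Cemb C a) x); apply: CabsD_lt.
have a0 : Cemb C a != 0 by rewrite -Cabs_gt0 (lt_le_trans x0).
exists (Cemb C a^-1); first by exists a^-1.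
rewrite fmorphV (_ : _ - _ = - (x - Cemb C a) / (x * Cemb C a)); last first.
  by field; rewrite n0 a0.
rewrite absM CabsN CabsV absM ltr_pdivrMr; last first.
  by rewrite mulr_gt0 // (lt_le_trans x0).
by apply: lt_le_trans h2 _; rewrite ler_pM2l // ler_pM2l.
Qed.

Variables (M : 'M[C]_2).
Hypotheses (KM : forall i j, K (M i j)) (detM : \det M != 0).

Let det2 : \det M = M 0 0 * M 1 1 - M 0 1 * M 1 0.
Proof.
rewrite (expand_det_row _ 0) !big_ord_recl big_ord0 addr0 /cofactor !det_mx11.
rewrite !mxE /= !addn0 !expr0 expr1 !mul1r mulN1r mulrN.
by congr (M _ _ * M _ _ - M _ _ * M _ _); apply/val_inj.
Qed.

Let affine_neq0 c d (z : Omega C) :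
  K c -> K d -> (c != 0) || (d != 0) -> c * toC z + d != 0.
Proof.
move=> Kc Kd cd; apply/eqP => h.
have [c0|c0] := eqVneq c 0.
  by move: h cd; rewrite c0 mul0r add0r => ->; rewrite eqxx.
have : K (toC z).
  rewrite (_ : toC z = - d / c); first by apply: KinftyM (KinftyN Kd) (KinftyV Kc).
  by apply: (mulfI c0); rewrite mulrCA divff // mulr1; apply/eqP; rewrite -addr_eq0 h.
by move=> Kz; case: (set_valP z Kz).
Qed.

Lemma autfactor_neq0 (z : Omega C) : autfactor M z != 0.
Proof.
apply: affine_neq0 => //; apply: contraNT detM; rewrite negb_or !negbK.
by case/andP=> /eqP h1 /eqP h2; rewrite det2 h1 h2 !mulr0 subrr.
Qed.

Lemma mobiusE (z : Omega C) :
  toC (mobius M z) = (M 0 0 * toC z + M 0 1) / (M 1 0 * toC z + M 1 1).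
Proof.
rewrite /toC /mobius val_insubd ifT //; apply/mem_set => Kw.
have j0 := autfactor_neq0 z.
set w := _ / _ in Kw.
have E : (M 0 0 - w * M 1 0) * toC z + (M 0 1 - w * M 1 1) = 0.
  have : w * autfactor M z = M 0 0 * toC z + M 0 1 by rewrite divfK.
  rewrite /autfactor => h; rewrite -(subrr (M 0 0 * toC z + M 0 1)) -{2}h.
  by ring.
have KB a b : K a -> K b -> K (a - w * b).
  by move=> Ka Kb; apply: KinftyD => //; apply: KinftyN; apply: KinftyM.
suff /(affine_neq0 z (KB _ _ (KM 0 0) (KM 1 0)) (KB _ _ (KM 0 1) (KM 1 1))) :
    (M 0 0 - w * M 1 0 != 0) || (M 0 1 - w * M 1 1 != 0) by rewrite E eqxx.
apply: contraNT detM; rewrite negb_or !negbK !subr_eq0 det2.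
by case/andP=> /eqP -> /eqP ->; apply/eqP; ring.
Qed.

End Action.

(* Main.v *)
(* For gamma in GL_2(A) let X = c / (cz + d).  Both halves of the theorem rest
   on two facts.

   First, E | gamma = E - w^-1 X for every gamma in GL_2(A); only w <> 0 is used
   of the Carlitz period.  For triangular gamma this is a reindexing of the
   double sum.  For z -> 1/z it says that the two orders of summation of
   sum_{a,b} (az + b)/(az + b) together give -1: truncate to deg a < N and
   deg b < N + e, where q^e <= |z| < q^(e+1).  The truncated sum is
   q^(2N+e) - 1 = -1, and the remainders tend to 0 because the power sums
   sum_{deg a < N} a^j vanish for j < N, so that expanding az/(az + b)
   geometrically only leaves terms of order N.  The Euclidean algorithm then
   gives all of GL_2(A).

   Second, at a fixed z, X takes infinitely many values on a congruence
   subgroup, so the expansion f | gamma = sum f_i X^i is an identity of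
   polynomials in X.  The cocycle relation for X shows that f_l is weakly
   modular of weight k - 2l and type m - l, and f - (-w)^l f_l E^l has smaller
   depth; the same polynomial argument gives uniqueness.

   Products of rigid analytic functions are rigid analytic because these
   functions are bounded on affinoids: a polynomial without zeros on an affinoid
   is bounded below there, since C_oo is algebraically closed. *)
Require Import Defs.
From HB Require Import structures.
From mathcomp Require Import all_boot all_order all_algebra fraction finmap.
From mathcomp Require Import all_classical all_reals all_analysis.
From mathcomp Require Import showcase.summability.
From mathcomp Require Import zify ring lra.

Set Implicit Arguments.
Unset Strict Implicit.
Unset Printing Implicit Defensive.

Import Order.TTheory GRing.Theory Num.Theory.
Import numFieldNormedType.Exports.

Local Open Scope classical_set_scope.
Local Open Scope ring_scope.

(** * Polynomials of bounded degree *)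

Section Polys.
Variable F : finFieldType.

(** The polynomials of degree below [N], enumerated by Horner's scheme so that sums can be taken
    over the constant coefficient first. *)
Fixpoint polys (N : nat) : seq {poly F} :=
  if N is N'.+1 then [seq a * 'X + c%:P | a <- polys N', c <- enum F]
  else [:: 0].

Lemma mem_polys N a : (a \in polys N) = (size a <= N)%N.
Proof.
elim: N a => [|N IH] a; first by rewrite inE leqn0 size_poly_eq0.
apply/allpairsP/idP => [[[b c] /= [hb _ ->]]|ha].
  rewrite size_MXaddC; case: ifP => // _; by rewrite ltnS -IH.
move: ha; elim/poly_ind: a => [|b c _].
  by move=> _; exists (0, 0); split;
    rewrite ?mem_enum ?IH ?size_poly0 // mul0r add0r.
rewrite size_MXaddC => h; exists (b, c); split; rewrite ?mem_enum // IH.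
by case: ifP h => [/andP[/eqP -> _] _|_]; rewrite ?size_poly0.
Qed.

Lemma MXaddC_inj (a b : {poly F}) c d :
  a * 'X + c%:P = b * 'X + d%:P -> a = b /\ c = d.
Proof.
move=> h; have hc : c = d.
  by have := congr1 (fun p => p.[0]) h; rewrite !hornerE.
split=> //; move: h; rewrite hc => /addIr; apply: mulIf.
by rewrite polyX_eq0.
Qed.

Lemma uniq_polys N : uniq (polys N).
Proof.
elim: N => [//|N IH] /=; apply: allpairs_uniq => //; first exact: enum_uniq.
by move=> [a c] [b d] _ _ /= /MXaddC_inj[-> ->].
Qed.

Lemma sum_polysS (V : zmodType) N (f : {poly F} -> V) :
  \sum_(a <- polys N.+1) f a =
  \sum_(a <- polys N) \sum_(c : F) f (a * 'X + c%:P).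
Proof.
rewrite /= -[LHS]/(\sum_(i <- [seq _ | _ <- _, _ <- _]) _) big_allpairs_dep /=.
by apply: eq_bigr => a _; rewrite big_enum.
Qed.

Lemma perm_polys N (s : seq {poly F}) :
  uniq s -> (forall a, a \in s = (size a <= N)%N) -> perm_eq (polys N) s.
Proof.
move=> us hs; apply: uniq_perm => //; first exact: uniq_polys.
by move=> a; rewrite mem_polys hs.
Qed.

Lemma sum_polys_split (V : zmodType) (P : pred {poly F}) (f : {poly F} -> V)
    N n : (N <= n)%N ->
  \sum_(a <- polys n | P a) f a =
  \sum_(a <- polys N | P a) f a +
  \sum_(a <- polys n | P a && (N < size a)%N) f a.
Proof.
move=> Nn; rewrite (bigID (fun a : {poly F} => (size a <= N)%N)) /=.
congr (_ + _); last by apply: eq_bigl => a; rewrite ltnNge.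
rewrite -big_filter -[RHS]big_filter; apply: perm_big; apply: uniq_perm.
- exact: filter_uniq (uniq_polys _).
- exact: filter_uniq (uniq_polys _).
move=> a; rewrite !mem_filter !mem_polys -andbA; case: (P a) => //=.
by apply/andP/idP => [[]//|h]; split=> //; apply: leq_trans h Nn.
Qed.

Lemma sum_reindex_polys (V : zmodType) (f : {poly F} -> V) N
    (h h' : {poly F} -> {poly F}) : cancel h h' -> cancel h' h ->
  (forall a, (size (h a) <= N)%N = (size a <= N)%N) ->
  \sum_(a <- polys N) f (h a) = \sum_(a <- polys N) f a.
Proof.
move=> hK h'K hN; rewrite -(big_map h xpredT f); apply: perm_big.
rewrite perm_sym; apply: perm_polys.
  by rewrite map_inj_uniq ?uniq_polys //; apply: can_inj hK.
move=> a; apply/mapP/idP => [[b]|ha].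
  by rewrite mem_polys => hb ->; rewrite hN.
by exists (h' a); rewrite ?h'K // mem_polys -hN h'K.
Qed.

End Polys.

(** * The absolute value on A and on C_oo *)

Section AbsoluteValue.
Context (R : realType) (F : finFieldType) (C : Cinfty R F).
Implicit Types (x y z : C) (a b : {poly F}).
Local Notation q := (#|F|%:R : R).

HB.instance Definition _ :=
  GRing.RMorphism.copy (embA C) (Cemb C \o @tofrac {poly F}).

Lemma Cabs_ge0 x : 0 <= Cabs x.
Proof. exact: (nonarch_ge0 (Cinfty_nonarch (CinftyP C))). Qed.

Lemma CabsM x y : Cabs (x * y) = Cabs x * Cabs y.
Proof. exact: (nonarch_mul (Cinfty_nonarch (CinftyP C))). Qed.

Lemma CabsD_le x y e : Cabs x <= e -> Cabs y <= e -> Cabs (x + y) <= e.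
Proof.
move=> hx hy; apply: le_trans (nonarch_add (Cinfty_nonarch (CinftyP C)) x y) _.
by rewrite ge_max hx.
Qed.

Lemma CabsB_le x y e : Cabs x <= e -> Cabs y <= e -> Cabs (x - y) <= e.
Proof. by move=> hx hy; apply: CabsD_le; rewrite ?CabsN. Qed.

Lemma CabsB_lt x y e : Cabs x < e -> Cabs y < e -> Cabs (x - y) < e.
Proof. by move=> hx hy; apply: CabsD_lt; rewrite ?CabsN. Qed.

Lemma CabsX x n : Cabs (x ^+ n) = Cabs x ^+ n.
Proof. by elim: n => [|n IH]; rewrite ?expr0 ?Cabs1 // !exprS CabsM IH. Qed.

Lemma Cabs_sum_le (I : eqType) (r : seq I) (P : pred I) (f : I -> C) e :
  0 <= e -> (forall i, i \in r -> P i -> Cabs (f i) <= e) ->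
  Cabs (\sum_(i <- r | P i) f i) <= e.
Proof.
move=> e0 h; rewrite big_seq_cond; elim/big_ind: _ => [||i /andP[]].
- by rewrite Cabs0.
- by move=> *; apply: CabsD_le.
- exact: h.
Qed.

(** If [x + y] were smaller than [x], then so would be [x = (x + y) - y], by the ultrametric
    inequality. *)
Lemma Cabs_dom x y : Cabs y < Cabs x -> Cabs (x + y) = Cabs x.
Proof.
move=> h; apply/eqP; rewrite eq_le; apply/andP; split.
  by apply: CabsD_le => //; apply: ltW.
rewrite leNgt; apply/negP => h2.
suff : Cabs x < Cabs x by rewrite ltxx.
by rewrite -{1}(addrK y x); apply: CabsB_lt.
Qed.

Lemma q_gt1 : 1 < q.
Proof. by rewrite ltr1n card_finNzRing_gt1. Qed.

Lemma q_gt0 : 0 < q. Proof. exact: lt_trans ltr01 q_gt1. Qed.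

Lemma qX_gt0 n : 0 < q ^+ n. Proof. by rewrite exprn_gt0 // q_gt0. Qed.

Lemma embA_eq0 a : (embA C a == 0) = (a == 0).
Proof. by rewrite /embA fmorph_eq0 tofrac_eq0. Qed.

Lemma Cabs_embA a : a != 0 -> Cabs (embA C a) = q ^+ (size a).-1.
Proof. exact: (Cinfty_deg (CinftyP C)). Qed.

Lemma Cabs_embA_le a N : (size a <= N.+1)%N -> Cabs (embA C a) <= q ^+ N.
Proof.
move=> h; have [->|a0] := eqVneq a 0.
  by rewrite /embA !rmorph0 Cabs0 ltW ?qX_gt0.
by rewrite Cabs_embA // ler_weXn2l ?(ltW q_gt1) // -subn1 leq_subLR.
Qed.

Lemma Cabs_embA_ge a N : (N < size a)%N -> q ^+ N <= Cabs (embA C a).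
Proof.
move=> h; have a0 : a != 0 by rewrite -size_poly_gt0; apply: leq_trans h.
by rewrite Cabs_embA // ler_weXn2l ?(ltW q_gt1) // -ltnS prednK ?size_poly_gt0.
Qed.

Lemma Cabs_embC (c : F) : Cabs (embA C c%:P) <= 1.
Proof. by rewrite -(expr0 q); apply: Cabs_embA_le; rewrite size_polyC_leq1. Qed.

Lemma qX_unbounded (e : R) : exists N, forall n, (N <= n)%N -> e < q ^+ n.
Proof.
exists (Num.bound e) => n hn; apply: lt_le_trans (upper_nthrootP hn) _.
by rewrite lerXn2r ?nnegrE ?(ltW q_gt0) // ler_nat card_finNzRing_gt1.
Qed.

(** The number q is 0 in C_oo: translation by 1 permutes [F], so the sums of [c] and of [c + 1]
    agree. *)
Lemma sumF_const x : \sum_(c : F) x = 0.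
Proof.
have h : \sum_(c : F) (1 : F) = 0.
  apply: (addrI (\sum_(c : F) c)); rewrite -big_split addr0 /=.
  by rewrite [RHS](reindex_inj (addIr (1 : F))).
rewrite (eq_bigr (fun=> embA C (1 : F)%:P * x)); last first.
  by move=> c _; rewrite polyC1 rmorph1 mul1r.
rewrite -mulr_suml.
rewrite -(rmorph_sum (embA C)) -(rmorph_sum (@polyC F)) /= h.
by rewrite !rmorph0 mul0r.
Qed.

Lemma Kinfty_embA a : Kinfty C (embA C a). Proof. exact: Kinfty_emb. Qed.

End AbsoluteValue.

(** * Limits and sums in C_oo *)

Section Limits.
Context (R : realType) (F : finFieldType) (C : Cinfty R F).
Implicit Types (x y z l : C) (a b : {poly F}) (u v : nat -> C).
Local Notation q := (#|F|%:R : R).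

Definition lim_to (u : nat -> C) (l : C) :=
  forall e : R, 0 < e -> exists N, forall n, (N <= n)%N -> Cabs (u n - l) < e.

Lemma Cabs_small0 x : (forall e : R, 0 < e -> Cabs x < e) -> x = 0.
Proof.
move=> h; apply/eqP; rewrite -Cabs_eq0 eq_le Cabs_ge0 andbT.
by apply/ler_addgt0Pl => e e0; rewrite addr0 ltW ?h.
Qed.

Lemma lim_to_unique u l l' : lim_to u l -> lim_to u l' -> l = l'.
Proof.
move=> h h'; apply/eqP; rewrite -subr_eq0; apply/eqP/Cabs_small0 => e e0.
have [N hN] := h e e0; have [N' hN'] := h' e e0.
rewrite (_ : l - l' = (u (maxn N N') - l') - (u (maxn N N') - l)); last by ring.
by apply: CabsB_lt; [apply: hN'; rewrite leq_maxr|apply: hN; rewrite leq_maxl].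
Qed.

Lemma lim_to_eventually u v l N :
  (forall n, (N <= n)%N -> u n = v n) -> lim_to u l -> lim_to v l.
Proof.
move=> uv h e e0; have [M hM] := h e e0; exists (maxn N M) => n.
by rewrite geq_max => /andP[h1 h2]; rewrite -uv // hM.
Qed.

Lemma lim_toD u v l l' :
  lim_to u l -> lim_to v l' -> lim_to (fun n => u n + v n) (l + l').
Proof.
move=> h h' e e0; have [N hN] := h e e0; have [N' hN'] := h' e e0.
exists (maxn N N') => n; rewrite geq_max => /andP[h1 h2].
by rewrite opprD addrACA; apply: CabsD_lt; [apply: hN|apply: hN'].
Qed.

Lemma lim_toZ x u l : lim_to u l -> lim_to (fun n => x * u n) (x * l).
Proof.
move=> h e e0; have [->|x0] := eqVneq x 0.
  by exists 0%N => n _; rewrite !mul0r subrr Cabs0.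
have x1 : 0 < Cabs x by rewrite Cabs_gt0.
have [N hN] := h _ (divr_gt0 e0 x1); exists N => n /hN.
by rewrite ltr_pdivlMr // -mulrBr CabsM mulrC.
Qed.

Lemma lim_to_sum (I : Type) (r : seq I) (u : I -> nat -> C) (l : I -> C) :
  (forall i, lim_to (u i) (l i)) ->
  lim_to (fun n => \sum_(i <- r) u i n) (\sum_(i <- r) l i).
Proof.
move=> h; elim: r => [|i r IH].
  by move=> e e0; exists 0%N => n _; rewrite !big_nil subrr Cabs0.
move=> e e0; have [N hN] := lim_toD (h i) IH e0.
by exists N => n /hN; rewrite !big_cons.
Qed.

Lemma lim_to_le u l x e : lim_to u l ->
  (exists N, forall n, (N <= n)%N -> Cabs (u n - x) <= e) -> Cabs (l - x) <= e.
Proof.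
move=> h [N hN]; rewrite leNgt; apply/negP => lt.
have l0 : 0 < Cabs (l - x).
  by apply: le_lt_trans lt; apply: le_trans (hN N _); rewrite ?Cabs_ge0.
have [M hM] := h _ l0.
have : Cabs (l - x) < Cabs (l - x); last by rewrite ltxx.
rewrite {1}(_ : l - x = (u (maxn N M) - x) - (u (maxn N M) - l)); last by ring.
apply: CabsB_lt; last by apply: hM; rewrite leq_maxr.
by apply: le_lt_trans lt; apply: hN; rewrite leq_maxl.
Qed.

Lemma cvg_Cabs0P (T : Type) (G : set_system T) (f : T -> C) : Filter G ->
  Cabs (f t) @[t --> G] --> (0 : R) <->
  forall e : R, 0 < e -> G [set t | Cabs (f t) < e].
Proof.
move=> FG; split=> [/cvgrPdist_lt h e /h|h].
  by apply: filterS => t /=; rewrite sub0r normrN ger0_norm ?Cabs_ge0.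
apply/cvgrPdist_lt => e /h; apply: filterS => t /=.
by rewrite sub0r normrN ger0_norm ?Cabs_ge0.
Qed.

Lemma cvg_lim_to u l : Cabs (u n - l) @[n --> \oo] --> (0 : R) -> lim_to u l.
Proof.
move=> /cvg_Cabs0P h e e0; have [N _ hN] := h e e0.
by exists N => n /hN.
Qed.

Lemma Clim_eq (T : Type) (G : set_system T) (f : T -> C) l : ProperFilter G ->
  (forall e : R, 0 < e -> G [set t | Cabs (f t - l) < e]) -> Clim G f = l.
Proof.
move=> PG h; rewrite /Clim; case: xgetP => [l' _ /= hl'|/(_ l) hn]; last first.
  by case: hn; apply/cvg_Cabs0P.
apply/eqP; rewrite -subr_eq0; apply/eqP/Cabs_small0 => e e0.
have h2 := (cvg_Cabs0P _ (@filter_filter _ _ PG)).1 hl' e e0.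
have [t [/= t1 t2]] := filter_ex (filterI (h e e0) h2).
have := CabsB_lt t1 t2; congr (_ < _); congr Cabs; ring.
Qed.

Lemma Cauchy_lim_to u :
  (forall e : R, 0 < e -> exists N, forall n, (N <= n)%N ->
     Cabs (u n - u N) < e) -> exists l, lim_to u l.
Proof.
move=> h; have [|l hl] := Cinfty_complete (CinftyP C) (u := u).
  move=> e e0; have [N hN] := h e e0; exists N => m n Nm Nn.
  rewrite (_ : u m - u n = (u m - u N) - (u n - u N)); last by ring.
  by apply: CabsB_lt; apply: hN.
by exists l; apply: cvg_lim_to.
Qed.

(** In a complete ultrametric field this already makes the family summable. *)
Definition vanishing (P : pred {poly F}) (u : {poly F} -> C) :=
  forall e : R, 0 < e -> exists N, forall a, P a -> (N < size a)%N -> Cabs (u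
    a) < e.

(** Unordered sums are computed by degree: the partial sums are Cauchy because all further terms are
    small, and a finite set containing [polys F N] adds only such small terms. *)
Lemma Csum_lim (P : pred {poly F}) (u : {poly F} -> C) : vanishing P u ->
  lim_to (fun N => \sum_(a <- polys F N | P a) u a) (Csum P u).
Proof.
move=> hu; pose S N := \sum_(a <- polys F N | P a) u a.
have tail N n e : 0 < e -> (N <= n)%N ->
    (forall a, P a -> (N < size a)%N -> Cabs (u a) < e) -> Cabs (S n - S N) < e.
  move=> e0 Nn hN; rewrite /S (sum_polys_split _ _ Nn) addrC addKr.
  elim/big_ind: _ => [||a /andP[]]; rewrite ?Cabs0 //; last exact: hN.
  by move=> *; apply: CabsD_lt.
have [l hl] : exists l, lim_to S l.
  apply: Cauchy_lim_to => e e0; have [N hN] := hu e e0.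
  by exists N => n Nn; apply: tail.
have PF : ProperFilter (@totally {poly F}) := totally_filter.
have tot e : 0 < e -> totally [set B : {fset {poly F}} |
    Cabs (\sum_(j <- B | P j) u j - l) < e].
  move=> e0; have [N1 hN1] := hu e e0; have [N2 hN2] := hl e e0.
  pose N := maxn N1 N2; exists (seq_fset tt (polys F N)) => // B NB /=.
  rewrite (bigID (fun a : {poly F} => (size a <= N)%N)) /= addrAC.
  apply: CabsD_lt.
    rewrite (_ : \sum_(i <- B | _) _ = S N); first by apply: hN2;
      rewrite leq_maxr.
    rewrite -big_filter /S -[RHS]big_filter; apply: perm_big; apply: uniq_perm.
    - exact: filter_uniq.
    - exact: filter_uniq (uniq_polys _ _).
    move=> a; rewrite !mem_filter mem_polys -andbA; case: (P a) => //=.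
    apply/andP/idP => [[]//|h]; split=> //.
    by apply: (fsubsetP NB); rewrite seq_fsetE mem_polys.
  elim/big_ind: _ => [|*|a /andP[Pa]]; rewrite ?Cabs0 //; first exact: CabsD_lt.
  by rewrite -ltnNge => ha; apply: hN1 => //;
    apply: leq_ltn_trans (leq_maxl _ _) ha.
by rewrite (_ : Csum P u = l) //; apply: Clim_eq.
Qed.

Lemma Csum_tail (P : pred {poly F}) (u : {poly F} -> C) N e :
  vanishing P u -> 0 <= e ->
  (forall a, P a -> (N < size a)%N -> Cabs (u a) <= e) ->
  Cabs (Csum P u - \sum_(a <- polys F N | P a) u a) <= e.
Proof.
move=> hu e0 hN; apply: lim_to_le (Csum_lim hu) _; exists N => n Nn.
rewrite (sum_polys_split _ _ Nn) addrC addKr.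
by apply: Cabs_sum_le => // a _ /andP[]; apply: hN.
Qed.

Lemma CsumZ (P : pred {poly F}) (u : {poly F} -> C) x :
  vanishing P u -> Csum P (fun a => x * u a) = x * Csum P u.
Proof.
move=> hu; have hxu : vanishing P (fun a => x * u a).
  move=> e e0; have x1 : 0 < Cabs x + 1 by rewrite ltr_wpDl ?Cabs_ge0.
  have [N hN] := hu _ (divr_gt0 e0 x1); exists N => a Pa ha.
  have := hN a Pa ha; rewrite ltr_pdivlMr // CabsM mulrC; apply: le_lt_trans.
  by rewrite ler_wpM2r ?Cabs_ge0 // lerDl.
apply: lim_to_unique (Csum_lim hxu) _.
apply: (@lim_to_eventually _ _ _ 0%N _ (lim_toZ x (Csum_lim hu))) => N _.
by rewrite mulr_sumr.
Qed.

End Limits.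

(** * Lattice sums *)

Section LatticeSums.
Context (R : realType) (F : finFieldType) (C : Cinfty R F).
Implicit Types (x y : C) (z : Omega C) (a b : {poly F}).
Local Notation q := (#|F|%:R : R).
Local Notation i := (embA C).

Lemma linear_form_neq0 z a b : (a != 0) || (b != 0) -> i a * toC z + i b != 0.
Proof.
move=> ab; apply/eqP => h; have [a0|a0] := eqVneq a 0.
  move: h ab; rewrite a0 rmorph0 mul0r add0r => /eqP.
  by rewrite embA_eq0 => ->; rewrite eqxx.
case: (set_valP z); rewrite -/(toC z).
have i0 : i a != 0 by rewrite embA_eq0.
rewrite (_ : toC z = - i b / i a).
  by apply: KinftyM; [apply: KinftyN|apply: KinftyV]; apply: Kinfty_embA.
by apply: (mulfI i0); rewrite mulrCA divff // mulr1; apply/eqP;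
  rewrite -addr_eq0 h.
Qed.

Lemma toC_neq0 z : toC z != 0.
Proof.
have := @linear_form_neq0 z 1 0.
by rewrite rmorph1 rmorph0 mul1r addr0 oner_eq0; apply.
Qed.

(** A point at distance 0 from K_oo would be a limit of elements of K, hence would lie in K_oo and
    not in Omega. *)
Lemma affinoid_exists z : exists n, affinoid C n z.
Proof.
have [n1 hn1] : exists n, forall x, Kinfty C x -> q ^- n <= Cabs (toC z - x).
  apply: contrapT => /forallNP h; case: (set_valP z); rewrite -/(toC z) => e e0.
  have [n /(_ n (leqnn n)) hn] := qX_unbounded F e^-1.
  have [x /not_implyP[Kx /negP]] := (existsNP _).2 (h n).
  rewrite -ltNge => hx; have [y hy xy] := Kx e e0; exists y => //.
  rewrite -(subrK x (toC z)) -addrA; apply: CabsD_lt => //.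
  by apply: lt_trans hx _; rewrite invf_plt ?posrE ?qX_gt0.
have [n2 /(_ _ (leqnn _)) hn2] := qX_unbounded F (Cabs (toC z)).
exists (maxn n1 n2); split=> [|x Kx].
  apply: le_trans (ltW hn2) _.
  by rewrite ler_weXn2l ?(ltW (q_gt1 R F)) // leq_maxr.
apply: le_trans (hn1 x Kx); rewrite lef_pV2 ?posrE ?qX_gt0 //.
by rewrite ler_weXn2l ?(ltW (q_gt1 R F)) // leq_maxl.
Qed.

Lemma affinoid_ge n z a b : affinoid C n z -> a != 0 ->
  q ^- n * Cabs (i a) <= Cabs (i a * toC z + i b).
Proof.
move=> [_ /(_ (- (i b / i a)))hz] a0; have i0 : i a != 0 by rewrite embA_eq0.
rewrite (_ : _ + _ = (toC z - - (i b / i a)) * i a); last by field.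
rewrite CabsM ler_wpM2r ?Cabs_ge0 //; apply: hz.
by apply: KinftyN; apply: KinftyM; [|apply: KinftyV]; apply: Kinfty_embA.
Qed.

(** Here [|az| <= q^(N+n) < q^M <= |b|], so [b] alone determines the size of the denominator. *)
Lemma lat_term_le n z N M a b : affinoid C n z -> (size a <= N.+1)%N ->
  (N + n < M)%N -> (M < size b)%N ->
  Cabs (i a / (i a * toC z + i b)) <= q ^+ N / q ^+ M.
Proof.
move=> [hz _] ha NM hb; have q1 := q_gt1 R F.
have bM : q ^+ M <= Cabs (i b) by apply: Cabs_embA_ge.
have az : Cabs (i a * toC z) < Cabs (i b).
  apply: le_lt_trans (_ : q ^+ (N + n) < _).
    by rewrite CabsM exprD ler_pM ?Cabs_ge0 ?Cabs_embA_le.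
  by apply: lt_le_trans bM; rewrite ltr_eXn2l.
rewrite CabsM CabsV addrC Cabs_dom //.
apply: ler_pM; rewrite ?Cabs_ge0 ?invr_ge0 ?Cabs_ge0 ?Cabs_embA_le //.
by rewrite lef_pV2 ?posrE ?qX_gt0 // (lt_le_trans _ bM) ?qX_gt0.
Qed.

Lemma lat_vanishing z a :
  vanishing predT (fun b => i a / (i a * toC z + i b)).
Proof.
move=> e e0; have [n hn] := affinoid_exists z.
have [M hM] := qX_unbounded F (q ^+ size a / e).
exists (maxn M (size a + n).+1) => b _ hb.
apply: le_lt_trans (lat_term_le hn (leqnSn _) _ hb) _; first exact: leq_maxr.
by rewrite ltr_pdivrMr ?qX_gt0 // mulrC -ltr_pdivrMr // hM // leq_maxl.
Qed.

Definition lat a z : C := Csum predT (fun b => i a / (i a * toC z + i b)).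

Lemma lat_lim a z :
  lim_to (fun N => \sum_(b <- polys F N) i a / (i a * toC z + i b)) (lat a z).
Proof. exact: (Csum_lim (lat_vanishing z a)). Qed.

(* Summing over the constants c first gains a factor:
   sum_c 1/(y+c) = - sum_c c/(y(y+c)), because sum_c 1/y = 0. *)
Lemma lat_le n z a : affinoid C n z -> a != 0 ->
  Cabs (lat a z) <= q ^+ (n + n) / Cabs (i a).
Proof.
move=> hz a0; rewrite -[lat a z]subr0; apply: lim_to_le (lat_lim a z) _.
have a1 : 0 < Cabs (i a) by rewrite Cabs_gt0 embA_eq0.
(* The truncation must be at least 1 for the constant coefficient to run through all of [F]. *)
exists 1%N => -[//|N] _; rewrite subr0 sum_polysS.
have e0 : 0 <= q ^+ (n + n) / Cabs (i a).
  by rewrite divr_ge0 ?Cabs_ge0 // ltW ?qX_gt0.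
apply: Cabs_sum_le => // b _ _.
pose y := i a * toC z + i (b * 'X).
have ge c : q ^- n * Cabs (i a) <= Cabs (y + i c%:P).
  by rewrite /y -addrA -rmorphD; apply: affinoid_ge.
have r0 : 0 < q ^- n * Cabs (i a) by rewrite mulr_gt0 ?invr_gt0 ?qX_gt0.
have nz c : y + i c%:P != 0 by rewrite -Cabs_gt0 (lt_le_trans r0).
have y0 : y != 0 by have := nz 0; rewrite polyC0 rmorph0 addr0.
rewrite (_ : \sum_c _ = \sum_(c : F) (i a / (i a * toC z + i (b * 'X + c%:P))
  - i a / y));
  last by rewrite sumrB sumF_const subr0.
apply: Cabs_sum_le => // c _ _.
rewrite (_ : _ - _ = - (i a * i c%:P) / (y * (y + i c%:P))); last first.
  by rewrite rmorphD addrA -/y; field; rewrite y0 nz.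
rewrite CabsM CabsN CabsM CabsV CabsM ler_pdivrMr; last first.
  by rewrite mulr_gt0 ?Cabs_gt0.
apply: (@le_trans _ _ (Cabs (i a)));
  first by rewrite ler_piMr ?Cabs_ge0 ?Cabs_embC.
rewrite -ler_pdivrMl ?divr_gt0 ?qX_gt0 //.
(* Each of the factors [y] and [y + c] is at least [q^-n |a|], whence the exponent [n + n]. *)
apply: (@le_trans _ _ ((q ^- n * Cabs (i a)) * (q ^- n * Cabs (i a)))).
  rewrite exprD; set Q := q ^+ n; set A := Cabs (i a).
  have Q0 : Q != 0 by rewrite gt_eqF ?qX_gt0.
  have A0 : A != 0 by rewrite gt_eqF.
  by rewrite (_ : _ * A = (Q^-1 * A) * (Q^-1 * A)) //; field; rewrite Q0 A0.
apply: ler_pM; rewrite ?(ltW r0) //.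
by have := ge 0; rewrite polyC0 rmorph0 addr0.
Qed.

Lemma lat0 z : lat 0 z = 0.
Proof.
apply: lim_to_unique (lat_lim 0 z) _ => e e0; exists 0%N => n _.
by rewrite subr0 big1 ?Cabs0 // => b _; rewrite rmorph0 !mul0r.
Qed.

Lemma outer_vanishing z : vanishing (fun a => a \is monic) (fun a => lat a z).
Proof.
move=> e e0; have [n hn] := affinoid_exists z.
have [N hN] := qX_unbounded F (q ^+ (n + n) / e).
exists N => a /monic_neq0 a0 ha; apply: le_lt_trans (lat_le hn a0) _.
rewrite ltr_pdivrMr ?Cabs_gt0 ?embA_eq0 // mulrC -ltr_pdivrMr //.
by apply: lt_le_trans (hN N _) (Cabs_embA_ge _ ha).
Qed.

(** The double series of E before division by the Carlitz period. *)
Definition lat_sum z : C := Csum (fun a => a \is monic) (fun a => lat a z).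

Lemma false_eisensteinE w z : false_eisenstein w z = w^-1 * lat_sum z.
Proof. by []. Qed.

Lemma lat_sum_tail n z N : affinoid C n z ->
  Cabs (lat_sum z - \sum_(a <- polys F N | a \is monic) lat a z) <=
  q ^+ (n + n) / q ^+ N.
Proof.
move=> hz; apply: (Csum_tail (outer_vanishing z)).
  by rewrite divr_ge0 // ltW ?qX_gt0.
move=> a /monic_neq0 a0 ha; apply: le_trans (lat_le hz a0) _.
rewrite ler_pM2l ?qX_gt0 // lef_pV2 ?posrE ?qX_gt0 ?Cabs_gt0 ?embA_eq0 //.
exact: Cabs_embA_ge.
Qed.

Lemma lat_tail n z N M a : affinoid C n z -> (size a <= N.+1)%N ->
  (N + n < M)%N ->
  Cabs (lat a z - \sum_(b <- polys F M) i a / (i a * toC z + i b)) <=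
  q ^+ N / q ^+ M.
Proof.
move=> hz ha NM; apply: (Csum_tail (lat_vanishing z a)).
  by rewrite divr_ge0 // ltW ?qX_gt0.
by move=> b _; apply: lat_term_le hz ha NM.
Qed.

Lemma size_affine_le (al de : F) (a : {poly F}) N b :
  al != 0 -> de != 0 -> (size a <= N)%N ->
  (size (al^-1 *: (de *: b + a)) <= N)%N = (size b <= N)%N.
Proof.
move=> al0 de0 ha; rewrite size_scale ?invr_eq0 //; apply/idP/idP => h.
  rewrite -(size_scale b de0) -(addrK a (de *: b)).
  by apply: leq_trans (size_polyD _ _) _; rewrite size_polyN geq_max h.
by apply: leq_trans (size_polyD _ _) _; rewrite size_scale // geq_max h.
Qed.

(** The substitution [b -> al^-1 (de b + a c)] multiplies the denominator [a z' + b] by [de / al],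
    and it permutes [polys F N] once [N] is at least [size (a * c)]. *)
Lemma lat_affine (al de : F) (c : {poly F}) z z' a : al != 0 -> de != 0 ->
  toC z' = (i al%:P * toC z + i c) / i de%:P ->
  lat a z' = i de%:P / i al%:P * lat a z.
Proof.
move=> al0 de0 hz'.
have ial : i al%:P != 0 by rewrite embA_eq0 polyC_eq0.
have ide : i de%:P != 0 by rewrite embA_eq0 polyC_eq0.
apply: lim_to_unique (lat_lim a z') _.
apply: (@lim_to_eventually _ _ _ _ _ _ (size (a * c))
  _ (lim_toZ (i de%:P / i al%:P) (lat_lim a z))).
move=> N hN; rewrite mulr_sumr.
pose h b := al^-1 *: (de *: b + a * c); pose h' b := de^-1 *: (al *: b - a * c).
have hK : cancel h h'.
  by move=> b; rewrite /h /h' scalerA mulfV // scale1r addrK scalerA mulVf //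
    scale1r.
have h'K : cancel h' h.
  by move=> b; rewrite /h /h' scalerA mulfV // scale1r subrK scalerA mulVf //
    scale1r.
have hs b : (size (h b) <= N)%N = (size b <= N)%N by apply: size_affine_le.
rewrite -(sum_reindex_polys _ hK h'K hs).
apply: eq_bigr => b _.
have [->|a0] := eqVneq a 0; first by rewrite rmorph0 !mul0r mulr0.
have hh : i (h b) = (i de%:P * i b + i a * i c) / i al%:P.
  apply: (mulIf ial); rewrite divfK // -!rmorphM -rmorphD /h; congr (i _).
  rewrite [LHS]mulrC.
  by rewrite !mul_polyC scalerA mulfV // scale1r.
have n1 := @linear_form_neq0 z' a b; rewrite a0 /= in n1.
have n2 := @linear_form_neq0 z a (h b); rewrite a0 /= in n2.
have {}n1 := n1 isT; have {}n2 := n2 isT; rewrite hz' in n1; rewrite hh in n2.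
rewrite hz' hh; set p := (X in _ = i a / X).
rewrite (_ : i a * toC z + _ = i de%:P / i al%:P * p); last first.
  by rewrite /p; field; rewrite ial ide.
by field; rewrite ial ide n1.
Qed.

Lemma lat_scale (c : F) z a : c != 0 -> lat (c *: a) z = lat a z.
Proof.
move=> c0; have ic : i c%:P != 0 by rewrite embA_eq0 polyC_eq0.
apply: lim_to_unique (lat_lim _ z) _.
apply: (@lim_to_eventually _ _ _ _ _ _ 0%N _ (lat_lim a z)) => N _.
have hK : cancel (fun b : {poly F} => c *: b) (fun b => c^-1 *: b).
  by move=> b /=; rewrite scalerA mulVf // scale1r.
have h'K : cancel (fun b : {poly F} => c^-1 *: b) (fun b => c *: b).
  by move=> b /=; rewrite scalerA mulfV // scale1r.
rewrite -[RHS](@sum_reindex_polys _ _ _ N _ _ hK h'K) => [|b]; last first.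
  by rewrite size_scale.
apply: eq_bigr => b _; rewrite -!mul_polyC !rmorphM.
rewrite (_ : i c%:P * i a * toC z + _ = i c%:P * (i a * toC z + i b));
  last by ring.
by rewrite -mulf_div divff // mul1r.
Qed.

(** By [lat_scale] each of the q - 1 nonzero leading coefficients contributes the monic sum, and q -
    1 is -1 in C_oo. This frees the series of E from the condition that [a] be monic. *)
Lemma sum_lat_polys N z :
  \sum_(a <- polys F N) lat a z =
  - \sum_(a <- polys F N | a \is monic) lat a z.
Proof.
pose S := \sum_(a <- polys F N | a \is monic) lat a z.
rewrite (partition_big (fun a : {poly F} => lead_coef a) xpredT) //=.
have hc (c : F) : c != 0 ->
    \sum_(a <- polys F N | lead_coef a == c) lat a z = S.
  move=> c0; rewrite /S big_mkcond [RHS]big_mkcond /=.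
  have hK : cancel (fun b : {poly F} => c *: b) (fun b => c^-1 *: b).
    by move=> b /=; rewrite scalerA mulVf // scale1r.
  have h'K : cancel (fun b : {poly F} => c^-1 *: b) (fun b => c *: b).
    by move=> b /=; rewrite scalerA mulfV // scale1r.
  rewrite -(@sum_reindex_polys _ _ _ N _ _ hK h'K) => [|b]; last first.
    by rewrite size_scale.
  apply: eq_bigr => a _; rewrite lat_scale // lead_coefZ monicE.
  by rewrite -[X in _ == X]mulr1 (inj_eq (mulfI c0)).
have := sumF_const S; rewrite (bigD1 (0 : F)) //= addrC => /eqP.
rewrite addr_eq0 => /eqP hS; rewrite (bigD1 (0 : F)) //= big1 ?add0r.
  by rewrite -/S -hS; apply: eq_bigr => c /hc.
by move=> a; rewrite lead_coef_eq0 => /eqP ->; rewrite lat0.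
Qed.

End LatticeSums.

(** * The inversion z -> 1/z *)

Section Inversion.
Context (R : realType) (F : finFieldType) (C : Cinfty R F).
Implicit Types (x y : C) (z : Omega C) (a b : {poly F}).
Local Notation q := (#|F|%:R : R).
Local Notation i := (embA C).

(** Split off the constant coefficient [c] and expand by the binomial theorem. The term free of [c]
    occurs q times and vanishes; the others contain power sums of exponent below [j], to which
    induction on [N] applies. *)
Lemma power_sum N j x y : (j < N)%N ->
  \sum_(a <- polys F N) (x + i a * y) ^+ j = 0.
Proof.
elim: N j x y => [//|N IH] j x y jN; rewrite sum_polysS.
pose X a := x + i a * (i 'X * y).
rewrite (eq_bigr (fun a => \sum_(k < j.+1) \sum_(c : F)
    X a ^+ (j - k) * ((i c%:P * y) ^+ k *+ 'C(j, k)))); last first.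
  move=> a _; rewrite exchange_big /=; apply: eq_bigr => c _.
  rewrite (_ : x + _ = X a + i c%:P * y); last first.
    by rewrite /X rmorphD rmorphM; ring.
  by rewrite exprDn; apply: eq_bigr => k _; rewrite mulrnAr.
rewrite exchange_big big1 //= => -[[|k] kj] _ /=.
  by rewrite big1 // => a _; under eq_bigr do rewrite expr0; apply: sumF_const.
rewrite exchange_big big1 //= => c _; rewrite -mulr_suml IH ?mul0r //.
by rewrite ltnS in kj; apply: leq_trans (_ : j <= N)%N => //;
  rewrite ltn_subrL /= (leq_trans _ kj).
Qed.

(* Expand geometrically: the first N power sums over [polys F N] vanish. *)
Lemma geometric_sum_le N y (rho : R) : 0 <= rho -> rho < 1 ->
  (forall a, (size a <= N)%N -> Cabs (i a * y) <= rho) ->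
  Cabs (\sum_(a <- polys F N) (1 - i a * y)^-1) <= rho ^+ N.
Proof.
move=> r0 r1 h.
have abs1 a : (size a <= N)%N -> Cabs (1 - i a * y) = 1.
  by move=> ha; rewrite Cabs_dom Cabs1 // CabsN (le_lt_trans (h a ha)).
rewrite (eq_big_seq (fun a => \sum_(k < N) (i a * y) ^+ k +
    (i a * y) ^+ N / (1 - i a * y))); last first.
  move=> a; rewrite mem_polys => ha.
  have n0 : 1 - i a * y != 0 by rewrite -Cabs_gt0 abs1.
  apply: (mulIf n0); rewrite mulVf // mulrDl divfK //.
  by rewrite -[_ ^+ N](subrK 1) subrX1; ring.
rewrite big_split /= exchange_big big1 ?add0r /=; last first.
  by move=> k _; rewrite -[RHS](power_sum 0 y (ltn_ord k));
    apply: eq_bigr => a _; rewrite add0r.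
apply: Cabs_sum_le => [|a]; first exact: exprn_ge0.
rewrite mem_polys => ha _; rewrite CabsM CabsV abs1 // invr1 mulr1 CabsX.
by rewrite lerXn2r ?nnegrE ?Cabs_ge0 ?h.
Qed.

(** Write [az/(az + b) = 1 - 1/(1 + az/b)]. The ones sum to 0 because [N] is positive, and
    [geometric_sum_le] bounds the rest. *)
Lemma column_sum_le N z b (rho : R) : (0 < N)%N -> 0 <= rho -> rho < 1 ->
  b != 0 ->
  (forall a, (size a <= N)%N -> Cabs (i a * toC z) <= rho * Cabs (i b)) ->
  Cabs (\sum_(a <- polys F N) i a * toC z / (i a * toC z + i b)) <= rho ^+ N.
Proof.
move=> N0 r0 r1 b0 h; have ib : i b != 0 by rewrite embA_eq0.
rewrite (eq_bigr (fun a => 1 - (1 - i a * - (toC z / i b))^-1)); last first.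
  move=> a _; have n0 : i a * toC z + i b != 0.
    by apply: linear_form_neq0; rewrite b0 orbT.
  by rewrite mulrN opprK mulrA; field; apply/andP; split; rewrite // addrC.
rewrite sumrB [X in X - _](_ : _ = 0) ?sub0r ?CabsN; last first.
  by rewrite -[RHS](power_sum 0 0 N0); apply: eq_bigr.
apply: geometric_sum_le => // a /h ha.
by rewrite mulrN CabsN mulrA CabsM CabsV ler_pdivrMr // Cabs_gt0.
Qed.

(** The error consists of the terms with [size b > M]. Summing them over [a] first makes each column
    at most [rho^N], and by the ultrametric inequality the number of columns does not matter. *)
Lemma truncation_le N M z (rho : R) : (0 < N)%N -> 0 <= rho -> rho < 1 ->
  (forall a b, (size a <= N)%N -> (M < size b)%N ->
     Cabs (i a * toC z) <= rho * Cabs (i b)) ->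
  Cabs (toC z * \sum_(a <- polys F N) lat a z -
    \sum_(a <- polys F N) \sum_(b <- polys F M)
      i a * toC z / (i a * toC z + i b)) <= rho ^+ N.
Proof.
move=> N0 r0 r1 h.
have hl := lim_toZ (toC z) (lim_to_sum (polys F N) (fun a => lat_lim a z)).
apply: lim_to_le hl _; exists M => n Mn.
rewrite mulr_sumr -sumrB (eq_bigr (fun a =>
    \sum_(b <- polys F n | (M < size b)%N) i a * toC z / (i a * toC z + i b)));
  last first.
  move=> a _; rewrite mulr_sumr (sum_polys_split predT _ Mn) /=
    [X in X + _ - _](_ : _ =
    \sum_(b <- polys F M) i a * toC z / (i a * toC z + i b)); last first.
    by apply: eq_bigr => b _; ring.
  by rewrite addrC addKr; apply: eq_bigr => b _; ring.
rewrite exchange_big /=; apply: Cabs_sum_le => [|b _ Mb];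
  first exact: exprn_ge0.
apply: column_sum_le => //; first by rewrite -size_poly_gt0 (leq_trans _ Mb).
by move=> a ha; apply: h.
Qed.

(** With [z' = 1/z] the second summand is [b/(az + b)], so the two add up to 1, except at
    [a = b = 0], where both are 0. The number of pairs [(a, b)] is 0 in C_oo, which leaves -1. *)
Lemma double_sum N M z z' : (0 < N)%N -> (0 < M)%N -> toC z' = (toC z)^-1 ->
  \sum_(a <- polys F N) \sum_(b <- polys F M) i a * toC z / (i a * toC z + i b)
  + \sum_(b <- polys F M) \sum_(a <- polys F N) i b * toC z' / (i b * toC z' +
    i a)
  = -1.
Proof.
move=> N0 M0 hz'; rewrite [X in _ + X]exchange_big /= -big_split /=.
have z0 := toC_neq0 z.
rewrite (eq_bigr (fun a => \sum_(b <- polys F M) (1 : C) - (a == 0)%:R));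
  last first.
  move=> a _; rewrite -big_split /=.
  rewrite (eq_bigr (fun b => 1 - (a == 0)%:R * (b == 0)%:R)).
    rewrite sumrB -mulr_sumr -[in RHS](mulr1 (a == 0)%:R); congr (_ - _ * _).
    rewrite (bigD1_seq 0) ?uniq_polys ?mem_polys ?size_poly0 //= eqxx big1
      ?addr0 //.
    by move=> b /negPf ->.
  move=> b _; have [/andP[/eqP -> /eqP ->]|ab] := boolP ((a == 0) && (b == 0)).
    by rewrite !eqxx rmorph0 !mul0r /= mulr1n mulr1 subrr addr0.
  have -> : (a == 0)%:R * (b == 0)%:R = 0 :> C.
    by move: ab; case: (a == 0); case: (b == 0); rewrite ?mulr0 ?mul0r.
  rewrite negb_and in ab; have n0 := linear_form_neq0 z ab.
  rewrite (_ : i b * toC z' + i a = (i a * toC z + i b) / toC z).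
    by rewrite hz'; field; rewrite n0 z0.
  by rewrite hz'; field.
rewrite sumrB (_ : \sum_(b <- polys F M) 1 = 0); last first.
  by rewrite -[RHS](power_sum 0 0 M0); apply: eq_bigr.
rewrite big1_eq (bigD1_seq 0) ?uniq_polys ?mem_polys ?size_poly0 //= eqxx big1
  ?addr0 ?sub0r //.
by move=> b /negPf ->.
Qed.

Lemma exists_degree (r : R) : 1 <= r -> exists e, q ^+ e <= r < q ^+ e.+1.
Proof.
move=> r1; have ex : exists n, r < q ^+ n.
  by have [n /(_ n (leqnn n)) hn] := qX_unbounded F r; exists n.
have := ex_minnP ex; case: ex_minnP => -[|n] hn hmin _.
  by move: hn; rewrite expr0 ltNge r1.
exists n; rewrite hn andbT leNgt; apply/negP => /hmin; by rewrite ltnn.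
Qed.

Lemma lat_sum_inv z z' : toC z' = (toC z)^-1 ->
  toC z * lat_sum z + toC z' * lat_sum z' = 1.
Proof.
(* The relation is symmetric in [z] and [z' = 1/z]. *)
wlog z1 : z z' / 1 <= Cabs (toC z).
  move=> wl h; have [/wl/(_ h)//|lt1] := leP 1 (Cabs (toC z)).
  rewrite addrC; apply: wl; last by rewrite h invrK.
  have z0 := toC_neq0 z.
  by rewrite h CabsV invf_ge1 ?Cabs_gt0 // ltW.
move=> hz'; have [e /andP[e1 e2]] := exists_degree z1.
(* One ratio for both truncations. In the first, [|a| <= q^N] and [|b| >= q^(N+e+1)], so
   [|az/b| <= |z|/q^(e+1)]. In the second, the summed variable is at most [q^(N+e)], hence at most
   [q^N] after division by [z], against [q^(N+1)]: the ratio is at most [1/q]. *)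
pose rho := Num.max (Cabs (toC z) / q ^+ e.+1) q^-1.
have rho1 : rho < 1.
  by rewrite gt_max ltr_pdivrMr ?qX_gt0 // mul1r e2 invf_lt1 ?q_gt0 ?q_gt1.
have rho0 : 0 <= rho by rewrite le_max invr_ge0 (ltW (q_gt0 R F)) orbT.
have zpos : 0 < Cabs (toC z) by apply: lt_le_trans z1.
have key N : Cabs (- (toC z * \sum_(a <- polys F N.+1) lat a z +
     toC z' * \sum_(a <- polys F (N + e).+1) lat a z') - 1) <= rho ^+ N.
  have h1 : Cabs (toC z * \sum_(a <- polys F N.+1) lat a z -
      \sum_(a <- polys F N.+1) \sum_(b <- polys F (N + e).+1)
      i a * toC z / (i a * toC z + i b)) <= rho ^+ N.
    apply: le_trans (_ : rho ^+ N.+1 <= _);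
      last by rewrite exprS ler_piMl ?exprn_ge0 // ltW.
    apply: truncation_le => // a b ha hb.
    have hb' := Cabs_embA_ge C hb.
    apply: le_trans (_ : (Cabs (toC z) / q ^+ e.+1) * q ^+ (N + e).+1 <= _).
      rewrite -addnS exprD [_ * q ^+ e.+1]mulrC mulrA divfK;
        last by rewrite gt_eqF ?qX_gt0.
      by rewrite CabsM mulrC ler_pM2l // Cabs_embA_le.
    by apply: ler_pM; rewrite ?divr_ge0 ?Cabs_ge0 ?(ltW (qX_gt0 _ _ _)) //
      le_max lexx.
  have h2 : Cabs (toC z' * \sum_(a <- polys F (N + e).+1) lat a z' -
      \sum_(b <- polys F (N + e).+1) \sum_(a <- polys F N.+1)
      i b * toC z' / (i b * toC z' + i a)) <= rho ^+ N.
    apply: le_trans (_ : rho ^+ (N + e).+1 <= _).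
      apply: truncation_le => // a b ha hb.
      have hb' := Cabs_embA_ge C hb.
      apply: le_trans (_ : q^-1 * q ^+ N.+1 <= _); last first.
        by apply: ler_pM; rewrite ?invr_ge0 ?(ltW (q_gt0 _ _)) ?(ltW (qX_gt0 _
          _ _)) // le_max lexx orbT.
      rewrite exprS mulKf ?gt_eqF ?q_gt0 // hz' CabsM CabsV ler_pdivrMr //.
      apply: le_trans (Cabs_embA_le _ ha) _.
      by rewrite exprD ler_pM2l ?qX_gt0.
    by rewrite ler_wiXn2l ?(ltW rho1) // -addnS leq_addr.
  have := double_sum (ltn0Sn N) (ltn0Sn (N + e)) hz'.
  move: h1 h2; set X := toC z * _; set Y := toC z' * _.
  set D1 := \sum_(a <- polys F N.+1) \sum_(b <- _) _.
  set D2 := \sum_(b <- polys F (N + e).+1) \sum_(a <- _) _.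
  move=> h1 h2 hD; rewrite (_ : _ - 1 = - (X - D1) - (Y - D2)).
    by apply: CabsB_le; rewrite ?CabsN.
  by rewrite -hD; ring.
have rho_lim : lim_to (fun N => - (toC z * \sum_(a <- polys F N.+1) lat a z +
     toC z' * \sum_(a <- polys F (N + e).+1) lat a z')) 1.
  move=> r r0.
  have rhon : `|rho| < 1 by rewrite ger0_norm.
  have /cvgrPdist_lt/(_ _ r0)[N0 _ hN0] := cvg_expr rhon.
  exists N0 => N NN; apply: le_lt_trans (key N) _.
  by have := hN0 N NN; rewrite /= sub0r normrN ger0_norm ?exprn_ge0.
(* The same sequence also tends to the left-hand side: [sum_lat_polys] yields minus the monic sums,
   which cancels the sign in front. *)
apply: lim_to_unique rho_lim => r r0.
have [N hN] := lim_toZ (toC z) (Csum_lim (outer_vanishing z)) r0.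
have [N' hN'] := lim_toZ (toC z') (Csum_lim (outer_vanishing z')) r0.
exists (maxn N N') => n; rewrite geq_max => /andP[Nn N'n].
rewrite !sum_lat_polys.
set S := \sum_(a <- polys F n.+1 | _) _;
  set S' := \sum_(a <- polys F (n + e).+1 | _) _.
rewrite (_ : _ - _ = (toC z * S - toC z * lat_sum z) +
  (toC z' * S' - toC z' * lat_sum z')); last by ring.
apply: CabsD_lt; first by apply: hN; apply: leq_trans Nn _.
by apply: hN'; apply: leq_trans N'n _; rewrite -addnS leq_addr.
Qed.

End Inversion.

(** * The transformation law under GL_2(A) *)

Section Matrices2.
Variable (A : comNzRingType).
Implicit Types (M N : 'M[A]_2) (a b c d : A).

Lemma sum_ord2 (V : zmodType) (f : 'I_2 -> V) : \sum_(k < 2) f k = f 0 + f 1.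
Proof.
rewrite !big_ord_recl big_ord0 addr0; congr (_ + f _); exact/val_inj.
Qed.

Lemma ord2P (k : 'I_2) : k = 0 \/ k = 1.
Proof. by case: k => [[|[|//]] ?]; [left|right]; apply: val_inj. Qed.

Lemma mulmx2E M N j k : (M *m N) j k = M j 0 * N 0 k + M j 1 * N 1 k.
Proof. by rewrite mxE sum_ord2. Qed.

Lemma det2E M : \det M = M 0 0 * M 1 1 - M 0 1 * M 1 0.
Proof.
rewrite (expand_det_row _ 0) sum_ord2 /cofactor !det_mx11 !mxE /=.
rewrite !addn0 expr0 expr1 mul1r mulN1r mulrN.
by congr (M _ _ * M _ _ - M _ _ * M _ _); apply/val_inj.
Qed.

Definition mx2 a b c d : 'M[A]_2 :=
  \matrix_(r, s) if r == 0 then (if s == 0 then a else b)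
                 else (if s == 0 then c else d).

Lemma mx2_00 a b c d : mx2 a b c d 0 0 = a. Proof. by rewrite mxE. Qed.
Lemma mx2_01 a b c d : mx2 a b c d 0 1 = b. Proof. by rewrite mxE. Qed.
Lemma mx2_10 a b c d : mx2 a b c d 1 0 = c. Proof. by rewrite mxE. Qed.
Lemma mx2_11 a b c d : mx2 a b c d 1 1 = d. Proof. by rewrite mxE. Qed.
Definition mx2E := (mx2_00, mx2_01, mx2_10, mx2_11).

Lemma mx2P M N : M 0 0 = N 0 0 -> M 0 1 = N 0 1 -> M 1 0 = N 1 0 ->
  M 1 1 = N 1 1 -> M = N.
Proof.
move=> h1 h2 h3 h4; apply/matrixP => r s.
by case: (ord2P r) => ->; case: (ord2P s) => ->.
Qed.

End Matrices2.

(** * The action of GL_2(A) and the law of E *)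

Section Action.
Context (R : realType) (F : finFieldType) (C : Cinfty R F).
Implicit Types (z : Omega C) (a b : {poly F}) (g h : 'M[{poly F}]_2).
Local Notation i := (embA C).

Definition mob g z : Omega C := mobius (map_mx i g) z.
Definition den g z : C := autfactor (map_mx i g) z.

Lemma toC_inj : injective (@toC R F C). Proof. exact: val_inj. Qed.

Lemma denE g z : den g z = i (g 1 0) * toC z + i (g 1 1).
Proof. by rewrite /den /autfactor !mxE. Qed.

Lemma det_embA_neq0 g : g \in unitmx -> i (\det g) != 0.
Proof.
by rewrite embA_eq0 unitmxE => h; apply: contraTneq h => ->; rewrite unitr0.
Qed.

Lemma den_neq0 g z : g \in unitmx -> den g z != 0.
Proof.
move=> hg; apply: autfactor_neq0 => [r s|]; first by rewrite mxE;
  apply: Kinfty_embA.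
by rewrite det_map_mx det_embA_neq0.
Qed.

Lemma mobE g z : g \in unitmx ->
  toC (mob g z) = (i (g 0 0) * toC z + i (g 0 1)) / den g z.
Proof.
move=> hg; rewrite /mob mobiusE => [|r s|]; first by rewrite denE !mxE.
  by rewrite mxE; apply: Kinfty_embA.
by rewrite det_map_mx det_embA_neq0.
Qed.

Lemma den_mul g h z : h \in unitmx ->
  den (g *m h) z = den g (mob h z) * den h z.
Proof.
move=> hh; rewrite [den g _]denE mobE // mulrDl mulrA divfK ?den_neq0 //.
by rewrite !denE !mulmx2E !rmorphD !rmorphM; ring.
Qed.

Lemma mob_mul g h z : g \in unitmx -> h \in unitmx ->
  mob (g *m h) z = mob g (mob h z).
Proof.
move=> hg hh; have hgh : g *m h \in unitmx by rewrite unitmx_mul hg.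
apply: toC_inj; rewrite !mobE // den_mul //.
have d1 := den_neq0 z hh; have d2 := den_neq0 (mob h z) hg.
rewrite [den g _ * _]mulrC invfM [LHS]mulrA; congr (_ / _).
by rewrite denE in d1 *; rewrite !mulmx2E !rmorphD !rmorphM; field.
Qed.

(** The cocycle relation of [X = c/(cz + d)], cleared of denominators. The determinant of [h] arises
    as [a (cz + d) - c (az + b)], with [a, b, c, d] the entries of [h]. *)
Lemma den_cocycle g h z : h \in unitmx ->
  den g (mob h z) * i (h 1 0) * den h z + i (\det h) * i (g 1 0) =
  i ((g *m h) 1 0) * den h z.
Proof.
move=> hh; have d1 := den_neq0 z hh.
rewrite [den g _]denE mobE // det2E mulmx2E rmorphB rmorphD !rmorphM !denE.
by field; move: d1; rewrite denE.
Qed.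

(** The transformation law of E multiplied by the period, which thereby disappears. *)
Definition eisenstein_law g := forall z,
  lat_sum (mob g z) =
  (i (\det g))^-1 * (den g z ^+ 2 * lat_sum z - i (g 1 0) * den g z).

Lemma eisenstein_law_mul g h : g \in unitmx -> h \in unitmx ->
  eisenstein_law g -> eisenstein_law h -> eisenstein_law (g *m h).
Proof.
move=> hg hh lg lh z; rewrite mob_mul // lg lh det_mulmx rmorphM den_mul //.
have n1 := det_embA_neq0 hg; have n2 := det_embA_neq0 hh.
have d1 := den_neq0 z hh.
have key := den_cocycle g z hh.
set J := den g _ in key *; set j := den h z in key d1 *.
rewrite [RHS](_ : _ = (i (\det g) * i (\det h))^-1 * ((J * j) ^+ 2 * lat_sum z -
   J * (i ((g *m h) 1 0) * j))); last by ring.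
by rewrite -key; field; apply/andP.
Qed.

Lemma lat_sum_affine (al de : F) (c : {poly F}) z z' : al != 0 -> de != 0 ->
  toC z' = (i al%:P * toC z + i c) / i de%:P ->
  lat_sum z' = i de%:P / i al%:P * lat_sum z.
Proof.
move=> al0 de0 hz'; rewrite /lat_sum -CsumZ; last exact: outer_vanishing.
by congr Csum; apply/funext => a; apply: lat_affine hz'.
Qed.

(** The diagonal entries divide a unit of [{poly F}], so they are nonzero constants and [g] acts by
    an affine map as in [lat_sum_affine]. *)
Lemma eisenstein_law_upper g : g \in unitmx -> g 1 0 = 0 -> eisenstein_law g.
Proof.
move=> hg g0 z; have := hg; rewrite unitmxE det2E g0 mulr0 subr0 unitrM.
rewrite !poly_unitE => /andP[/andP[/size_poly1P[al al0 hal] _]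
  /andP[/size_poly1P[de de0 hde] _]].
have hm := mobE z hg; rewrite denE g0 rmorph0 mul0r add0r hal hde in hm.
rewrite (lat_sum_affine al0 de0 hm) denE g0 rmorph0 !mul0r add0r subr0 hal hde
  rmorphM.
have ial : i al%:P != 0 by rewrite embA_eq0 polyC_eq0.
have ide : i de%:P != 0 by rewrite embA_eq0 polyC_eq0.
by field; apply/andP; split.
Qed.

Lemma eisenstein_law_swap : eisenstein_law (mx2 0 1 1 0).
Proof.
move=> z; have hS : mx2 0 1 1 0 \in (@unitmx {poly F} 2).
  by rewrite unitmxE det2E !mx2E mul0r mulr1 sub0r unitrN1.
have hm := mobE z hS; rewrite denE !mx2E rmorph0 rmorph1 mul0r mul1r add0r
  addr0 mul1r in hm.
have z0 := toC_neq0 z.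
have := lat_sum_inv hm; rewrite hm denE det2E !mx2E mul0r mulr1 sub0r.
rewrite rmorphN !rmorph0 !rmorph1 addr0 !mul1r invrN invr1 => h.
have : toC z * (toC z * lat_sum z + (toC z)^-1 * lat_sum (mob (mx2 0 1 1 0)
  z)) = toC z by rewrite h mulr1.
rewrite mulrDr mulrA mulrA divff // mul1r => {}h.
by rewrite -[lat_sum (mob _ _)](addKr (toC z * toC z * lat_sum z)) h; ring.
Qed.

(* GL_2(A) is generated by upper triangular matrices and the swap, by the
   Euclidean algorithm on the first column. *)
Lemma eisenstein_law_GL2 g : g \in unitmx -> eisenstein_law g.
Proof.
have [n] := ubnP (size (g 1 0)); elim: n g => // n IH g hn hg.
have [g0|g0] := eqVneq (g 1 0) 0; first exact: eisenstein_law_upper.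
pose Q := g 0 0 %/ g 1 0.
(* [h] is the row swap of [T^-1 g]; its lower left entry is the remainder of [g 0 0] modulo [g 1 0],
   of smaller size. *)
pose h := mx2 (g 1 0) (g 1 1) (g 0 0 - Q * g 1 0) (g 0 1 - Q * g 1 1).
pose T := mx2 1 Q 0 1; pose S : 'M[{poly F}]_2 := mx2 0 1 1 0.
have uT : T \in unitmx by rewrite unitmxE det2E !mx2E mulr1 mulr0 subr0 unitr1.
have uS : S \in unitmx by rewrite unitmxE det2E !mx2E mul0r mulr1 sub0r unitrN1.
have gE : g = T *m (S *m h).
  by apply: mx2P; rewrite !mulmx2E !mx2E; ring.
have uSh : S *m h \in unitmx by have := hg; rewrite gE unitmx_mul => /andP[].
have uh : h \in unitmx by have := uSh; rewrite unitmx_mul => /andP[].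
rewrite gE; apply: eisenstein_law_mul => //.
  by apply: eisenstein_law_upper => //; rewrite mx2E.
apply: eisenstein_law_mul => //; first exact: eisenstein_law_swap.
apply: IH => //; rewrite mx2E.
rewrite (_ : _ - _ = g 0 0 %% g 1 0); last first.
  by apply/eqP; rewrite subr_eq addrC; apply/eqP; apply: divp_eq.
by rewrite ltnS in hn; apply: leq_trans hn; rewrite ltn_modp.
Qed.

End Action.

(** * C_oo is algebraically closed *)

(** Subsets closed under the field operations are made into field types, so that K_oo and its
    algebraic closure inside C_oo can serve as fields of coefficients. *)
Record subfield_set (L : fieldType) := SubfieldSet {
  subfield_carrier :> set L;
  subfield_closed : GRing.divring_closed (fun x => `[< subfield_carrier x >])
}.

Definition subfield_pred (L : fieldType) (S : subfield_set L) : {pred L} :=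
  fun x => `[< subfield_carrier S x >].

HB.instance Definition _ (L : fieldType) (S : subfield_set L) :=
  GRing.isDivringClosed.Build L (subfield_pred S) (subfield_closed S).

Record subfield_type (L : fieldType) (S : subfield_set L) := SubfieldType {
  subfield_val : L;
  subfield_valP : subfield_val \in subfield_pred S
}.

HB.instance Definition _ (L : fieldType) (S : subfield_set L) :=
  [isSub for @subfield_val L S].
HB.instance Definition _ (L : fieldType) (S : subfield_set L) :=
  [Choice of subfield_type S by <:].
HB.instance Definition _ (L : fieldType) (S : subfield_set L) :=
  [SubChoice_isSubIntegralDomain of subfield_type S by <:].
HB.instance Definition _ (L : fieldType) (S : subfield_set L) :=
  [SubIntegralDomain_isSubField of subfield_type S by <:].

Section Subfields.
Variables (L : fieldType) (S : subfield_set L).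
Local Notation v := (val : subfield_type S -> L).

Lemma subfield_set_val (x : subfield_type S) : subfield_carrier S (v x).
Proof. by apply/asboolP; have := valP x. Qed.

Lemma subfield_lift (p : {poly L}) : (forall i, subfield_carrier S p`_i) ->
  exists p' : {poly subfield_type S}, map_poly v p' = p.
Proof.
move=> hp; exists (\poly_(i < size p) insubd 0 p`_i); apply/polyP => i.
rewrite coef_map coef_poly; case: ltnP => [_|h];
  last by rewrite nth_default ?raddf0.
by rewrite /= insubdK //; apply/asboolP.
Qed.

Lemma algebraic_elementsP x :
  algebraic_elements S x <-> algebraicOver v x.
Proof.
split=> [[p p0 [/subfield_lift[p' hp] rp]]|[p p0 rp]].
  exists p'; last by rewrite hp.
  by apply: contraNneq p0 => p0; rewrite -hp p0 rmorph0.
exists (map_poly v p); first by rewrite map_poly_eq0.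
by split=> // i; rewrite coef_map; apply: subfield_set_val.
Qed.

Lemma algebraic_elements_closed :
  GRing.divring_closed (fun x => `[< algebraic_elements S x >]).
Proof.
split; first by apply/asboolP/algebraic_elementsP; apply: algebraic1.
  move=> x y /asboolP/algebraic_elementsP hx /asboolP/algebraic_elementsP hy.
  by apply/asboolP/algebraic_elementsP; apply: algebraic_sub.
move=> x y /asboolP/algebraic_elementsP hx /asboolP/algebraic_elementsP hy.
by apply/asboolP/algebraic_elementsP; apply: algebraic_div.
Qed.

Lemma algebraically_closed_type : algebraically_closed S ->
  forall p : {poly subfield_type S}, (1 < size p)%N -> exists x, root p x.
Proof.
move=> hS p p1; have [||x Sx] := hS (map_poly v p).
- by move=> i; rewrite coef_map; apply: subfield_set_val.
- by rewrite size_map_poly.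
have Px : x \in subfield_pred S by apply/asboolP.
by rewrite -[x]/(v (SubfieldType Px)) fmorph_root => h;
  exists (SubfieldType Px).
Qed.

End Subfields.

Lemma poly_split (L : fieldType) :
  (forall p : {poly L}, (1 < size p)%N -> exists x, root p x) ->
  forall p : {poly L}, exists rs : seq L,
    p = lead_coef p *: \prod_(x <- rs) ('X - x%:P).
Proof.
move=> hL p; have [n] := ubnP (size p); elim: n p => // n IH p pn.
have [p1|p1] := ltnP 1 (size p); last first.
  exists [::]; rewrite big_nil; move: (size1_polyC p1); move: p`_0 => c ->.
  by rewrite lead_coefC alg_polyC.
have [x /factor_theorem[q pq]] := hL p p1.
have q0 : q != 0 by apply: contraTneq p1 => q0; rewrite pq q0 mul0r size_poly0.
have [|rs hrs] := IH q.
  by move: pn; rewrite pq size_Mmonic ?monicXsubC // size_XsubC addn2 ltnS.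
exists (x :: rs); rewrite big_cons pq lead_coef_Mmonic ?monicXsubC //.
by rewrite {1}hrs mulrC scalerAr.
Qed.

(** * Roots in C_oo as limits of roots of split polynomials *)

Section AlgebraicallyClosed.
Context (R : realType) (F : finFieldType) (C : Cinfty R F).
Implicit Types (x y : C) (p r : {poly C}).

Lemma Kinfty_closed :
  GRing.divring_closed (fun x => `[< Kinfty C x >]).
Proof.
split; first by apply/asboolP; rewrite -(rmorph1 (Cemb C)); apply: Kinfty_emb.
  move=> x y /asboolP hx /asboolP hy.
  by apply/asboolP; apply: KinftyD => //; apply: KinftyN.
move=> x y /asboolP hx /asboolP hy.
by apply/asboolP; apply: KinftyM => //; apply: KinftyV.
Qed.

Definition Kinfty_subfield := SubfieldSet Kinfty_closed.
Definition Kinfty_alg_subfield :=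
  SubfieldSet (algebraic_elements_closed Kinfty_subfield).

Lemma horner_le p x (d B : R) : 1 <= B -> Cabs x <= B -> 0 <= d ->
  (forall j, Cabs p`_j <= d) -> Cabs p.[x] <= d * B ^+ size p.
Proof.
move=> B1 xB d0 h; rewrite horner_coef.
apply: Cabs_sum_le => [|j _ _];
  first by rewrite mulr_ge0 // exprn_ge0 // (le_trans ler01).
rewrite CabsM CabsX; apply: ler_pM; rewrite ?exprn_ge0 ?Cabs_ge0 //.
apply: le_trans (_ : B ^+ j <= _); last by rewrite ler_weXn2l // ltnW.
by rewrite lerXn2r ?nnegrE ?Cabs_ge0 // (le_trans ler01).
Qed.

(** If [|x| > B >= 1], the leading term is strictly larger than every other term and cannot be
    cancelled. *)
Lemma monic_root_le p x (B : R) : p \is monic -> 1 <= B ->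
  (forall j, Cabs p`_j <= B) -> root p x -> Cabs x <= B.
Proof.
move=> pm B1 h rx; rewrite leNgt; apply/negP => xB.
have x1 : 1 < Cabs x by apply: le_lt_trans xB.
have xp : 0 < Cabs x by apply: lt_trans x1.
move: rx (monic_neq0 pm) => /eqP; rewrite horner_coef.
move: pm => /monicP; rewrite lead_coefE;
  case: (size p) (size_poly_eq0 p) => [|[|n]] hs pn.
- by move=> _; rewrite -hs eqxx.
- by rewrite big_ord_recl big_ord0 pn expr0 mulr1 addr0 => /eqP;
  rewrite oner_eq0.
rewrite big_ord_recr /= pn mul1r => /eqP; rewrite addrC addr_eq0 => /eqP e _.
suff : Cabs x ^+ n.+1 < Cabs x ^+ n.+1 by rewrite ltxx.
rewrite -{1}CabsX e CabsN; apply: le_lt_trans (_ : B * Cabs x ^+ n < _).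
  apply: Cabs_sum_le => [|j _ _].
    by rewrite mulr_ge0 ?exprn_ge0 ?Cabs_ge0 // (le_trans ler01).
  rewrite CabsM CabsX ler_pM ?exprn_ge0 ?Cabs_ge0 //.
  by rewrite ler_weXn2l ?(ltW x1) // -ltnS.
by rewrite exprS ltr_pM2r // exprn_gt0.
Qed.

(** The algebraic closure of K_oo is dense in C_oo, so the coefficients can be moved into it, and
    there the polynomial splits. *)
Lemma approx_split p (d : R) : p \is monic -> 0 < d ->
  exists rs : seq C, let r := \prod_(x <- rs) ('X - x%:P) in
    size r = size p /\ forall j, Cabs (r`_j - p`_j) < d.
Proof.
move=> pm d0.
have /choice[y hy] (c : C) : exists y, subfield_carrier Kinfty_alg_subfield y
  /\ Cabs (c - y) < d.
  have : setT c by []; rewrite -(Cinfty_dense (CinftyP C)) => /(_ d d0)[y ? ?].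
  by exists y.
(* The leading coefficient is set to 1 exactly, so that [p1] stays monic of the same size. *)
pose p1 := \poly_(j < size p) (if j == (size p).-1 then 1 else y p`_j).
have sp : (0 < size p)%N by rewrite size_poly_gt0 monic_neq0.
have sp1 : size p1 = size p by rewrite size_poly_eq // eqxx oner_neq0.
have p1m : p1 \is monic.
  by rewrite monicE lead_coefE sp1 coef_poly prednK // leqnn eqxx.
have hp1 j : subfield_carrier Kinfty_alg_subfield p1`_j.
  have := rpred1 (subfield_pred Kinfty_alg_subfield).
  have := rpred0 (subfield_pred Kinfty_alg_subfield).
  rewrite coef_poly => /asboolP h0 /asboolP h1.
  by case: ifP => // _; case: ifP => // _; have [] := hy p`_j.
have [p2 hp2] := subfield_lift hp1.
have cl : algebraically_closed (subfield_carrier Kinfty_alg_subfield).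
  exact: Cinfty_closed (CinftyP C).
have [rs hrs] := poly_split (algebraically_closed_type cl) p2.
exists (map val rs) => r.
have -> : r = p1.
  rewrite -hp2 hrs.
  have -> : lead_coef p2 = 1.
    by apply: (fmorph_inj val); rewrite -lead_coef_map rmorph1; move: p1m;
      rewrite -hp2 => /monicP.
  rewrite scale1r rmorph_prod /r big_map; apply: eq_bigr => x _.
  exact/esym/map_polyXsubC.
split=> // j; rewrite coef_poly; case: ltnP => [jp|jp]; last first.
  by rewrite nth_default // subr0 Cabs0.
case: eqP => [->|_]; last by rewrite -CabsN opprB; have [] := hy p`_j.
by rewrite -lead_coefE (monicP pm) subrr Cabs0.
Qed.

(** Used for the distances from a point to the roots of a split polynomial: a small value forces a
    root nearby. *)
Lemma min_factor (s : seq R) : (forall t, t \in s -> 0 <= t) -> s != [::] ->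
  exists2 t, t \in s & t ^+ size s <= \prod_(u <- s) u.
Proof.
move=> s0 sn.
have [t ts tmin] : exists2 t, t \in s & forall u, u \in s -> t <= u.
  elim: s sn {s0} => // a [|b s] IH _.
    by exists a; rewrite ?mem_head // => u; rewrite inE => /eqP ->.
  have [//|t ts tm] := IH; have [at_|ta] := leP a t.
    exists a; first exact: mem_head.
    by move=> u; rewrite inE => /orP[/eqP->//|/tm]; apply: le_trans.
  exists t; first by rewrite inE ts orbT.
  by move=> u; rewrite inE => /orP[/eqP->|/tm//]; apply: ltW.
exists t => //; elim: s tmin s0 {sn} ts => // a s IH tmin s0 ts.
have t0 := s0 t ts.
have {}IH : t ^+ size s <= \prod_(u <- s) u.
  elim: s tmin {IH s0 ts} => [|b s IH] tmin; first by rewrite big_nil.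
  rewrite big_cons /= exprS; apply: ler_pM; rewrite ?exprn_ge0 //.
    by apply: tmin; rewrite !inE eqxx orbT.
  apply: IH => u; rewrite inE => /orP[/eqP ->|us]; apply: tmin.
    exact: mem_head.
  by rewrite !inE us !orbT.
by rewrite big_cons /= exprS; apply: ler_pM; rewrite ?exprn_ge0 ?tmin ?mem_head.
Qed.

Lemma Cabs_prod (I : Type) (s : seq I) (f : I -> C) :
  Cabs (\prod_(j <- s) f j) = \prod_(j <- s) Cabs (f j).
Proof. by elim: s => [|a s IH]; rewrite ?big_nil ?Cabs1 // !big_cons CabsM IH.
  Qed.

(* One step of a root search: the split approximations of p have a root close
   to x as soon as p(x) is small. *)
Lemma nearby_root p x (e : R) : p \is monic -> (1 < size p)%N -> 0 < e ->
  exists y, Cabs (x - y) ^+ (size p).-1 <= Num.max (Cabs p.[x]) e /\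
    Cabs p.[y] <= e.
Proof.
move=> pm p1 e0.
(* [B] bounds [x] and the coefficients of [p], and, through [monic_root_le], the roots of the
   approximation as well. *)
pose B : R := 1 + Cabs x + \sum_(j < size p) Cabs p`_j.
have s0 : 0 <= \sum_(j < size p) Cabs p`_j by apply: sumr_ge0 => j _;
  apply: Cabs_ge0.
have B1 : 1 <= B by rewrite /B -addrA lerDl addr_ge0 ?Cabs_ge0.
have xB : Cabs x <= B by rewrite /B addrAC lerDr addr_ge0.
have pB j : Cabs p`_j <= B.
  have [jp|jp] := ltnP j (size p);
    last by rewrite nth_default // Cabs0 (le_trans ler01).
  rewrite /B (bigD1 (Ordinal jp)) //= addrCA lerDl !addr_ge0 ?Cabs_ge0 //.
  by apply: sumr_ge0 => k _; apply: Cabs_ge0.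
pose N := size p; have BN : 0 < B ^+ N by rewrite exprn_gt0 // (lt_le_trans
  ltr01).
(* The bound 1 keeps the coefficients of the approximation [r] within [B]; the bound [e / B^N] makes
   [r] and [p] differ by at most [e] at points of size at most [B]. *)
pose d := Num.min 1 (e / B ^+ N).
have d0 : 0 < d by rewrite lt_min ltr01 divr_gt0.
have [rs] := approx_split pm d0; set r := \prod_(_ <- _) _ => /= -[sr hr].
have diff u : Cabs u <= B -> Cabs (r.[u] - p.[u]) <= e.
  move=> uB; rewrite -hornerN -hornerD.
  apply: le_trans (_ : d * B ^+ size (r - p) <= _).
    by apply: horner_le => // [|j]; rewrite ?(ltW d0) // coefB ltW.
  apply: le_trans (_ : d * B ^+ N <= _).
    rewrite ler_pM2l // ler_weXn2l //.
    by apply: leq_trans (size_polyD _ _) _; rewrite size_polyN sr maxnn.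
  by rewrite -ler_pdivlMr // ge_min lexx orbT.
have srs : size rs = N.-1.
  have := sr; rewrite /r size_prod_XsubC /N => <-; by [].
have [||t /mapP[y yrs ->]] := @min_factor [seq Cabs (x - y) | y <- rs].
- by move=> t /mapP[y _ ->]; apply: Cabs_ge0.
- by rewrite -size_eq0 size_map srs -lt0n -subn1 subn_gt0.
rewrite size_map big_map srs => ht; exists y; split.
  apply: le_trans ht _; rewrite -Cabs_prod.
  have -> : \prod_(j <- rs) (x - j) = r.[x].
    by rewrite /r horner_prod; apply: eq_bigr => u _; rewrite hornerXsubC.
  rewrite -(subrK p.[x] r.[x]); apply: CabsD_le; rewrite le_max ?lexx ?orbT //.
  by rewrite diff ?orbT.
have ry : root r y by rewrite /r root_prod_XsubC.
have rm : r \is monic by apply: monic_prod_XsubC.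
have yB : Cabs y <= B.
  apply: (monic_root_le rm B1 _ ry) => j; rewrite -(subrK p`_j r`_j).
  apply: CabsD_le => //; apply: le_trans (ltW (hr j)) _.
  by rewrite ge_min B1.
by have := diff y yB; rewrite (rootP ry) sub0r CabsN.
Qed.

Lemma lim_toM (u v : nat -> C) l l' : lim_to u l -> lim_to v l' ->
  lim_to (fun n => u n * v n) (l * l').
Proof.
move=> hu hv e e0.
pose B := Cabs l' + 1; have B0 : 0 < B by rewrite ltr_wpDl ?Cabs_ge0.
have [N1 h1] := hv 1 ltr01.
have [N2 h2] := hu _ (divr_gt0 e0 B0).
have [N3 h3] := lim_toZ l hv e0.
exists (maxn N1 (maxn N2 N3)) => n; rewrite !geq_max => /and3P[n1 n2 n3].
rewrite (_ : _ - _ = (u n - l) * v n + (l * v n - l * l')); last by ring.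
apply: CabsD_lt; last exact: h3.
rewrite CabsM; have := h2 n n2; rewrite ltr_pdivlMr //; apply: le_lt_trans.
rewrite ler_wpM2l ?Cabs_ge0 // -(subrK l' (v n)); apply: CabsD_le.
  by apply: le_trans (ltW (h1 n n1)) _; rewrite lerDr Cabs_ge0.
by rewrite lerDl.
Qed.

Lemma lim_to_horner p (u : nat -> C) l : lim_to u l ->
  lim_to (fun n => p.[u n]) p.[l].
Proof.
move=> hu; elim/poly_ind: p => [|p c IH].
  by move=> e e0; exists 0%N => n _; rewrite !horner0 subrr Cabs0.
have hc : lim_to (fun=> c) c by move=> e e0; exists 0%N => n _;
  rewrite subrr Cabs0.
have := lim_toD (lim_toM IH hu) hc; rewrite hornerMXaddC.
by apply: (@lim_to_eventually _ _ _ _ _ _ 0%N) => n _; rewrite hornerMXaddC.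
Qed.

(** Iterating [nearby_root] with precision [h n ^+ d] makes successive steps at most [h n], so the
    iterates converge, and [p] vanishes at the limit by continuity. *)
Lemma Cinfty_root p : (1 < size p)%N -> exists x, root p x.
Proof.
wlog pm : p / p \is monic.
  move=> wl p1; have l0 : lead_coef p != 0.
    by rewrite lead_coef_eq0 -size_poly_gt0 ltnW.
  have [||x] := wl ((lead_coef p)^-1 *: p).
  - by rewrite monicE lead_coefZ mulVf.
  - by rewrite size_scale ?invr_eq0.
  by rewrite rootZ ?invr_eq0 // => h; exists x.
move=> p1; set d := (size p).-1;
  have d0 : (0 < d)%N by rewrite -ltnS prednK // ltnW.
pose h (n : nat) : R := 2^-1 ^+ n.
have h0 n : 0 < h n by rewrite exprn_gt0 // invr_gt0.
have hS n : h n.+1 <= h n by rewrite /h exprS ler_piMl ?ltW // invf_lt1 ?ltr1n.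
have /choice[f hf] (xn : C * nat) : exists y,
    Cabs (xn.1 - y) ^+ d <= Num.max (Cabs p.[xn.1]) (h xn.2 ^+ d) /\
    Cabs p.[y] <= h xn.2 ^+ d.
  by apply: nearby_root => //; rewrite exprn_gt0.
pose u := fix u n := if n is n'.+1 then f (u n', n') else 0.
(* The starting point 0 is arbitrary, so the estimates begin with [u 1]. *)
have pu n : Cabs p.[u n.+1] <= h n ^+ d by have [] := hf (u n, n).
have du n : Cabs (u n.+2 - u n.+1) <= h n.
  have [+ _] := hf (u n.+1, n.+1);
    rewrite -[f _]/(u n.+2) /= -CabsN opprB => hd.
  rewrite -(ler_pXn2r d0) ?nnegrE ?Cabs_ge0 ?(ltW (h0 n)) //.
  by apply: le_trans hd _; rewrite ge_max pu lerXn2r ?nnegrE ?(ltW (h0 _)).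
have hanti N n : (N <= n)%N -> h n <= h N.
  by move=> Nn; rewrite /h ler_wiXn2l ?invr_ge0 // invf_le1 ?ler1n.
have tail N n : (N <= n)%N -> Cabs (u n.+1 - u N.+1) <= h N.
  elim: n => [|n IH]; first by rewrite leqn0 => /eqP ->;
    rewrite subrr Cabs0 ltW.
  rewrite leq_eqVlt ltnS => /orP[/eqP ->|Nn]; first by rewrite subrr Cabs0 ltW.
  rewrite (_ : _ - _ = (u n.+2 - u n.+1) + (u n.+1 - u N.+1)); last by ring.
  by apply: CabsD_le; [apply: le_trans (du n) (hanti _ _ Nn)|apply: IH].
have hsmall e : 0 < e -> exists N, h N < e.
  move=> e0; exists (Num.bound e^-1);
    rewrite /h exprVn invf_plt ?posrE ?exprn_gt0 //.
  exact: upper_nthrootP.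
have [l hl] : exists l, lim_to (fun n => u n.+1) l.
  apply: Cauchy_lim_to => e /hsmall[N hN]; exists N => n Nn.
  by apply: le_lt_trans hN; apply: tail.
exists l; apply/rootP;
  apply: lim_to_unique (lim_to_horner p hl) _ => e /hsmall[N hN].
exists N => n Nn; rewrite subr0; apply: le_lt_trans (pu n) _;
  apply: le_lt_trans hN.
apply: le_trans (hanti _ _ Nn);
  rewrite -[leRHS]expr1 ler_wiXn2l ?(ltW (h0 n)) //.
by rewrite /h exprn_ile1 ?invr_ge0 // invf_le1 ?ler1n.
Qed.

End AlgebraicallyClosed.

(** * Rigid analytic functions *)

Section RigidAnalytic.
Context (R : realType) (F : finFieldType) (C : Cinfty R F).
Implicit Types (x y : C) (z : Omega C) (a b : {poly F}) (f h : Omega C -> C).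
Local Notation q := (#|F|%:R : R).
Local Notation i := (embA C).

(** A point [x] closer to [z] than [q^-n] has the same distances to K_oo as [z] and still satisfies
    [|x| <= q^n], so it would belong to the affinoid. *)
Lemma affinoid_root_le n z x : affinoid C n z ->
  (forall z' : Omega C, toC z' = x -> ~ affinoid C n z') ->
  q ^- n <= Cabs (toC z - x).
Proof.
move=> [hz1 hz2] hx; rewrite leNgt; apply/negP => lt.
have dist y : Kinfty C y -> Cabs (x - y) = Cabs (toC z - y).
  move=> Ky; rewrite -[LHS](_ : Cabs ((toC z - y) + (x - toC z)) = _);
    last by congr Cabs; ring.
  by apply: Cabs_dom; rewrite -CabsN opprB; apply: lt_le_trans lt (hz2 y Ky).
have Ox : Omega C x.
  by move=> Kx; move: lt; rewrite ltNge hz2.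
apply: (hx (SigSub (mem_set Ox))) => //; split=> [|y Ky];
  last by rewrite dist ?hz2.
rewrite -[toC _]/x -[x](subrK (toC z)); apply: CabsD_le => //.
rewrite -CabsN opprB; apply: le_trans (ltW lt) _.
apply: (@le_trans _ _ 1);
  first by rewrite invf_le1 ?qX_gt0 // exprn_ege1 // ltW ?q_gt1.
by rewrite exprn_ege1 // ltW ?q_gt1.
Qed.

Lemma poly_bounded n (p : {poly C}) :
  exists B : R, forall z, affinoid C n z -> Cabs p.[toC z] <= B.
Proof.
pose d : R := \sum_(j < size p) Cabs p`_j.
exists (d * (q ^+ n) ^+ size p) => z [hz _].
have s0 (P : pred 'I_(size p)) : 0 <= \sum_(j < size p | P j) Cabs p`_j.
  by apply: sumr_ge0 => j _; apply: Cabs_ge0.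
apply: horner_le => // [||j]; first by rewrite exprn_ege1 // ltW ?q_gt1.
  exact: s0.
have [jp|jp] := ltnP j (size p); last by rewrite nth_default // Cabs0 s0.
by rewrite /d (bigD1 (Ordinal jp)) //= lerDl s0.
Qed.

(** Factor [r] over C_oo. No root lies in the affinoid, so each linear factor is at least [q^-n]
    there. *)
Lemma poly_bounded_below n (r : {poly C}) :
  (forall z, affinoid C n z -> r.[toC z] != 0) ->
  exists2 d : R, 0 < d & forall z, affinoid C n z -> d <= Cabs r.[toC z].
Proof.
move=> r0; have [rs hr] := poly_split (@Cinfty_root R F C) r.
have [rz|rn] := eqVneq r 0.
  by exists 1 => // z /r0; rewrite rz horner0 eqxx.
exists (Cabs (lead_coef r) * (q ^- n) ^+ size rs).
  by rewrite mulr_gt0 ?exprn_gt0 ?invr_gt0 ?qX_gt0 // Cabs_gt0 lead_coef_eq0.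
move=> z hz; rewrite [in leRHS]hr hornerZ CabsM ler_pM2l ?Cabs_gt0
  ?lead_coef_eq0 //.
have : forall x, x \in rs -> q ^- n <= Cabs (toC z - x).
  move=> x xrs; apply: affinoid_root_le => // z' hz' /r0; rewrite hz' hr.
  rewrite hornerZ mulf_eq0 negb_or => /andP[_ /negP]; apply.
  by have := root_prod_XsubC rs x; rewrite xrs.
elim: rs {hr} => [|x rs IH] h; first by rewrite big_nil hornerE Cabs1.
rewrite big_cons hornerM CabsM exprS hornerXsubC; apply: ler_pM.
- by rewrite invr_ge0 ltW ?qX_gt0.
- by rewrite exprn_ge0 // invr_ge0 ltW ?qX_gt0.
- by apply: h; rewrite mem_head.
- by apply: IH => y yrs; apply: h; rewrite inE yrs orbT.
Qed.

Lemma rigid_bounded f n : rigid_analytic f ->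
  exists2 B : R, 0 < B & forall z, affinoid C n z -> Cabs (f z) <= B.
Proof.
move=> /(_ n 1 ltr01)[p [r hpr]].
have [B hB] := poly_bounded n p.
have [d d0 hd] := poly_bounded_below (fun z hz => (hpr z hz).1).
exists (Num.max 1 (B / d)); first by rewrite lt_max ltr01.
move=> z hz; rewrite -(subrK (p.[toC z] / r.[toC z]) (f z)); apply: CabsD_le.
  by rewrite le_max (ltW (hpr z hz).2).
rewrite le_max CabsM CabsV ler_pM ?orbT ?Cabs_ge0 ?invr_ge0 ?Cabs_ge0 ?hB //.
by rewrite lef_pV2 ?posrE ?hd // (lt_le_trans d0) ?hd.
Qed.

Lemma rigid_limit f : (forall n (e : R), 0 < e -> exists2 h, rigid_analytic h &
    forall z, affinoid C n z -> Cabs (f z - h z) < e) -> rigid_analytic f.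
Proof.
move=> hf n e e0; have [h rh fh] := hf n e e0; have [p [r hpr]] := rh n e e0.
exists p, r => z hz; have [r0 hr] := hpr z hz; split=> //.
by rewrite -(subrK (h z) (f z)) -addrA; apply: CabsD_lt => //; apply: fh.
Qed.

Lemma rigid_cst c : rigid_analytic (fun _ : Omega C => c).
Proof.
move=> n e e0; exists c%:P, 1 => z _; rewrite !hornerC oner_neq0 divr1 subrr.
by rewrite Cabs0.
Qed.

Lemma rigidD f h : rigid_analytic f -> rigid_analytic h ->
  rigid_analytic (fun z => f z + h z).
Proof.
move=> hf hh n e e0; have [p [r hpr]] := hf n e e0.
have [p' [r' hpr']] := hh n e e0; exists (p * r' + p' * r), (r * r') => z hz.
have [r0 fr] := hpr z hz; have [r0' hr] := hpr' z hz.
rewrite hornerD !hornerM mulf_neq0 //; split=> //.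
rewrite (_ : _ - _ = (f z - p.[toC z] / r.[toC z]) +
  (h z - p'.[toC z] / r'.[toC z])); first exact: CabsD_lt.
by field; apply/andP.
Qed.

(* The products of approximations converge because rigid analytic functions
   are bounded on affinoids. *)
Lemma rigidM f h : rigid_analytic f -> rigid_analytic h ->
  rigid_analytic (fun z => f z * h z).
Proof.
move=> hf hh n e e0; have [B B0 hB] := rigid_bounded n hf.
have [B' B0' hB'] := rigid_bounded n hh.
have [p [r hpr]] := hf n _ (divr_gt0 e0 B0').
have e1 : 0 < Num.min B' (e / B) by rewrite lt_min B0' divr_gt0.
(* The larger of [B] and [e / B'] bounds the approximation [u] of [f], and so fixes the precision
   needed for [h]. *)
have Bpos : 0 < Num.max B (e / B') by rewrite lt_max B0.
have e2 : 0 < e / Num.max B (e / B') by rewrite divr_gt0.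
have [p' [r' hpr']] := hh n _ e2.
exists (p * p'), (r * r') => z hz.
have [r0 fr] := hpr z hz; have [r0' hr] := hpr' z hz.
rewrite !hornerM mulf_neq0 //; split=> //.
set u := p.[toC z] / r.[toC z] in fr.
set u' := p'.[toC z] / r'.[toC z] in hr.
rewrite (_ : _ - _ = (f z - u) * h z + u * (h z - u')); last first.
  by rewrite /u /u'; field; apply/andP.
apply: CabsD_lt; rewrite CabsM.
  move: fr; rewrite ltr_pdivlMr //; apply: le_lt_trans.
  by rewrite ler_wpM2l ?Cabs_ge0 ?hB'.
move: hr; rewrite ltr_pdivlMr // mulrC; apply: le_lt_trans.
rewrite ler_wpM2r ?Cabs_ge0 // -[u](subrK (f z)); apply: CabsD_le.
  by rewrite -CabsN opprB le_max (ltW fr) orbT.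
by rewrite le_max hB.
Qed.

Lemma rigid_sum (I : Type) (s : seq I) (P : pred I) (f : I -> Omega C -> C) :
  (forall j, P j -> rigid_analytic (f j)) ->
  rigid_analytic (fun z => \sum_(j <- s | P j) f j z).
Proof.
move=> hf; elim: s => [|j s IH].
  rewrite [X in rigid_analytic X](_ : _ = fun=> (0 : C));
    first exact: rigid_cst.
  by apply/funext => z; rewrite big_nil.
rewrite [X in rigid_analytic X](_ : _ = fun z => (if P j then f j z else 0) +
    \sum_(j <- s | P j) f j z); last first.
  by apply/funext => z; rewrite big_cons; case: (P j); rewrite ?add0r.
by apply: rigidD => //; case Pj: (P j); [apply: hf|apply: rigid_cst].
Qed.

Lemma rigid_lat_term a b :
  rigid_analytic (fun z : Omega C => i a / (i a * toC z + i b)).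
Proof.
have [->|a0] := eqVneq a 0.
  rewrite [X in rigid_analytic X](_ : _ = fun=> (0 : C));
    first exact: rigid_cst.
  by apply/funext => z; rewrite rmorph0 !mul0r.
move=> n e e0; exists (i a)%:P, (i a *: 'X + (i b)%:P) => z _.
rewrite hornerD hornerZ hornerX !hornerC subrr Cabs0; split=> //.
by apply: linear_form_neq0; rewrite a0.
Qed.

(** Uniformly on an affinoid, the outer sum is cut at [N] by [lat_sum_tail] and then all remaining
    inner sums at a common [M] by [lat_tail], which leaves a rational function. *)
Lemma rigid_lat_sum : rigid_analytic (@lat_sum R F C).
Proof.
apply: rigid_limit => n e e0.
have [N /(_ N (leqnn N)) hN] := qX_unbounded F (q ^+ (n + n) / e).
have [M0 hM0] := qX_unbounded F (q ^+ N / e).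
pose M := maxn M0 (N + n).+1.
have hM : q ^+ N / e < q ^+ M by apply: hM0; rewrite leq_maxl.
exists (fun z => \sum_(a <- polys F N | a \is monic) \sum_(b <- polys F M)
    i a / (i a * toC z + i b)).
  by apply: rigid_sum => a _; apply: rigid_sum => b _; apply: rigid_lat_term.
move=> z hz.
rewrite -(subrK (\sum_(a <- polys F N | a \is monic) lat a z) (lat_sum z))
  -addrA.
apply: CabsD_lt.
  apply: le_lt_trans (lat_sum_tail N hz) _.
  by rewrite ltr_pdivrMr ?qX_gt0 // mulrC -ltr_pdivrMr.
rewrite -sumrB; apply: le_lt_trans (_ : q ^+ N / q ^+ M < _); last first.
  by rewrite ltr_pdivrMr ?qX_gt0 // mulrC -ltr_pdivrMr.
apply: Cabs_sum_le => [|a]; first by rewrite divr_ge0 ?(ltW (qX_gt0 _ _ _)).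
rewrite mem_polys => ha _; apply: (lat_tail hz); first exact: leqW.
exact: leq_maxr.
Qed.

End RigidAnalytic.

(** * Expansions in the cocycle *)

Section Slash.
Context (R : realType) (F : finFieldType) (C : Cinfty R F).
Implicit Types (x y : C) (z : Omega C) (a b : {poly F}) (f : Omega C -> C).
Implicit Types (g h : 'M[{poly F}]_2) (k m : int).
Local Notation i := (embA C).

Definition cocycle g z : C := i (g 1 0) / den g z.

Lemma slashE k m f g z :
  slash k m f g z = i (\det g) ^ m * den g z ^ (- k) * f (mob g z).
Proof. by rewrite /slash det_map_mx. Qed.

(** For fixed [h] and [z], passing from [g] to [g *m h] is an affine substitution in the cocycle.
    Hence expansions transform by composition with a polynomial of degree 1. *)
Lemma cocycle_mul g h z : g \in unitmx -> h \in unitmx ->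
  cocycle (g *m h) z =
  i (\det h) / den h z ^+ 2 * cocycle g (mob h z) + cocycle h z.
Proof.
move=> hg hh; rewrite /cocycle den_mul //.
have d1 := den_neq0 z hh; have d2 := den_neq0 (mob h z) hg.
have -> : i ((g *m h) 1 0) = (den g (mob h z) * i (h 1 0) * den h z +
    i (\det h) * i (g 1 0)) / den h z by rewrite den_cocycle // mulfK.
by field; apply/andP.
Qed.

Lemma slash_mul k m f g h z : g \in unitmx -> h \in unitmx ->
  slash k m f (g *m h) z =
  i (\det h) ^ m * den h z ^ (- k) * slash k m f g (mob h z).
Proof.
move=> hg hh; rewrite !slashE det_mulmx rmorphM den_mul // mob_mul //.
by rewrite !expfzMl; ring.
Qed.

Lemma slashM k1 k2 m1 m2 f1 f2 g z : g \in unitmx ->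
  slash (k1 + k2) (m1 + m2) (fun z => f1 z * f2 z) g z =
  slash k1 m1 f1 g z * slash k2 m2 f2 g z.
Proof.
move=> hg; rewrite !slashE opprD !expfzDr ?den_neq0 ?det_embA_neq0 //; ring.
Qed.

Lemma slash_linear k m x f1 f2 g z :
  slash k m (fun z => x * f1 z + f2 z) g z =
  x * slash k m f1 g z + slash k m f2 g z.
Proof. by rewrite !slashE; ring. Qed.

Lemma slash1 k m f z : slash k m f 1%:M z = f z.
Proof.
have u1 : 1%:M \in @unitmx {poly F} 2 by apply: unitmx1.
have d1 : den 1%:M z = 1 by rewrite denE !mxE rmorph0 rmorph1 mul0r add0r.
rewrite slashE det1 d1 rmorph1 !exp1rz !mul1r; congr f; apply: toC_inj.
by rewrite mobE // d1 !mxE rmorph0 rmorph1 mul1r addr0 divr1.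
Qed.

Lemma false_eisenstein_slash w g z : g \in unitmx ->
  slash 2 1 (false_eisenstein w) g z = false_eisenstein w z - w^-1 * cocycle g
    z.
Proof.
move=> hg; rewrite slashE !false_eisensteinE eisenstein_law_GL2 // /cocycle.
have d1 := den_neq0 z hg; have d2 := det_embA_neq0 C hg.
rewrite expr1z (_ : den g z ^ (- 2) = den g z ^- 2) //.
by move: w^-1 => v; field; apply/andP.
Qed.

Lemma nonzero_ideal_setI (A : idomainType) (I J : set A) :
  nonzero_ideal I -> nonzero_ideal J -> nonzero_ideal (I `&` J).
Proof.
move=> [I0 ID IM [x Ix x0]] [J0 JD JM [y Jy y0]]; split=> //.
- by move=> u v [? ?] [? ?]; split; [apply: ID|apply: JD].
- by move=> a u [? ?]; split; [apply: IM|apply: JM].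
exists (x * y); last by rewrite mulf_neq0.
by split; [rewrite mulrC; apply: IM|apply: JM].
Qed.

Lemma periodic_cst x : periodic_analytic C (fun=> x).
Proof.
split; first exact: rigid_cst.
by exists setT => //; split=> //; exists 1; rewrite ?oner_neq0.
Qed.

Lemma periodicD f1 f2 : periodic_analytic C f1 -> periodic_analytic C f2 ->
  periodic_analytic C (fun z => f1 z + f2 z).
Proof.
move=> [r1 [I1 hI1 h1]] [r2 [I2 hI2 h2]]; split; first exact: rigidD.
exists (I1 `&` I2); first exact: nonzero_ideal_setI.
by move=> a [a1 a2] z z' hz; rewrite (h1 a a1 _ _ hz) (h2 a a2 _ _ hz).
Qed.

Lemma periodicM f1 f2 : periodic_analytic C f1 -> periodic_analytic C f2 ->
  periodic_analytic C (fun z => f1 z * f2 z).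
Proof.
move=> [r1 [I1 hI1 h1]] [r2 [I2 hI2 h2]]; split; first exact: rigidM.
exists (I1 `&` I2); first exact: nonzero_ideal_setI.
by move=> a [a1 a2] z z' hz; rewrite (h1 a a1 _ _ hz) (h2 a a2 _ _ hz).
Qed.

Lemma periodic_sum (s : seq nat) (f : nat -> Omega C -> C) :
  (forall j, periodic_analytic C (f j)) ->
  periodic_analytic C (fun z => \sum_(j <- s) f j z).
Proof.
move=> hf; elim: s => [|j s IH].
  rewrite [X in periodic_analytic C X](_ : _ = fun=> (0 : C)).
    exact: periodic_cst.
  by apply/funext => z; rewrite big_nil.
rewrite [X in periodic_analytic C X](_ : _ =
    fun z => f j z + \sum_(j <- s) f j z); first exact: periodicD.
by apply/funext => z; rewrite big_cons.
Qed.

Lemma periodic_false_eisenstein w :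
  periodic_analytic C (@false_eisenstein R F C w).
Proof.
have rE : rigid_analytic (@false_eisenstein R F C w).
  by apply: rigidM; [apply: rigid_cst|apply: rigid_lat_sum].
split=> //; exists setT.
  by split=> //; exists 1; rewrite ?oner_neq0.
move=> a _ z z' hz; rewrite !false_eisensteinE; congr (_ * _).
rewrite (@lat_sum_affine _ _ _ 1 1 a z) ?oner_neq0 //.
  by rewrite divff ?mul1r // embA_eq0 polyC_eq0 oner_neq0.
by rewrite hz polyC1 rmorph1 mul1r divr1.
Qed.

End Slash.

(** * Quasi-modular functions as polynomials in the cocycle *)

Section Expansions.
Context (R : realType) (F : finFieldType) (C : Cinfty R F).
Variables (G : set 'M[{poly F}]_2) (hG : GL2_subgroup G).
Implicit Types (x y w : C) (z : Omega C) (f h : Omega C -> C).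
Implicit Types (g : 'M[{poly F}]_2) (k m : int) (P : Omega C -> {poly C}).
Local Notation i := (embA C).

Lemma G_unit g : G g -> g \in unitmx.
Proof. by case: hG => h _ _ _ /h. Qed.

Lemma G_1 : G 1%:M. Proof. by case: hG. Qed.

(* The coefficients f_0, ..., f_l at z are gathered in one polynomial. *)
Definition expansion k m (l : nat) f P : Prop :=
  [/\ rigid_analytic f, forall z, (size (P z) <= l.+1)%N,
      forall j, periodic_analytic C (fun z => (P z)`_j) &
      forall g, G g -> forall z, slash k m f g z = (P z).[cocycle g z]].

Lemma cocycle1 z : cocycle 1%:M z = 0.
Proof. by rewrite /cocycle !mxE rmorph0 mul0r. Qed.

Lemma expansion_widen k m l l' f P : (l <= l')%N ->
  expansion k m l f P -> expansion k m l' f P.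
Proof. by move=> ll' [rf sP cP hP]; split=> // z; apply: leq_trans (sP z) _.
  Qed.

Lemma expansion_cst0 k m l : expansion k m l (fun=> 0) (fun=> 0).
Proof.
split=> [|z|j|g _ z]; first exact: rigid_cst.
- by rewrite size_poly0.
- rewrite [X in periodic_analytic C X](_ : _ = fun=> (0 : C)).
    exact: periodic_cst.
  by apply/funext => z; rewrite coef0.
- by rewrite slashE mulr0 horner0.
Qed.

Lemma expansion_linear k m l x f1 f2 P1 P2 :
  expansion k m l f1 P1 -> expansion k m l f2 P2 ->
  expansion k m l (fun z => x * f1 z + f2 z) (fun z => x *: P1 z + P2 z).
Proof.
move=> [r1 s1 c1 h1] [r2 s2 c2 h2]; split=> [|z|j|g Gg z].
- by apply: rigidD => //; apply: rigidM => //; apply: rigid_cst.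
- apply: leq_trans (size_polyD _ _) _; rewrite geq_max s2 andbT.
  exact: leq_trans (size_scale_leq _ _) (s1 z).
- rewrite [X in periodic_analytic C X](_ : _ = fun z => x * (P1 z)`_j + (P2
  z)`_j).
    by apply: periodicD => //; apply: periodicM => //; apply: periodic_cst.
  by apply/funext => z; rewrite coefD coefZ.
- by rewrite slash_linear h1 // h2 // hornerD hornerZ.
Qed.

Lemma expansionM k1 k2 m1 m2 l1 l2 f1 f2 P1 P2 :
  expansion k1 m1 l1 f1 P1 -> expansion k2 m2 l2 f2 P2 ->
  expansion (k1 + k2) (m1 + m2) (l1 + l2) (fun z => f1 z * f2 z)
    (fun z => P1 z * P2 z).
Proof.
move=> [r1 s1 c1 h1] [r2 s2 c2 h2]; split=> [|z|j|g Gg z].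
- exact: rigidM.
- by move: (size_polyMleq (P1 z) (P2 z)) (s1 z) (s2 z); lia.
- rewrite [X in periodic_analytic C X](_ : _ =
      fun z => \sum_(n <- iota 0 j.+1) (P1 z)`_n * (P2 z)`_(j - n)).
    by apply: periodic_sum => n; apply: periodicM.
  by apply/funext => z; rewrite coefM -(big_mkord xpredT (fun n => (P1 z)`_n *
    (P2 z)`_(j - n))).
- by rewrite slashM ?G_unit // h1 // h2 // hornerM.
Qed.

(** The cocycle vanishes at the identity matrix, so only the constant term remains there. *)
Lemma expansion_eq k m l f P z : expansion k m l f P -> f z = (P z)`_0.
Proof.
by move=> [_ _ _ /(_ _ G_1 z)]; rewrite slash1 cocycle1 horner_coef0.
Qed.

(** An expansion may have vanishing top coefficients, whereas exact depth forbids this. The depth is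
    the largest index whose coefficient function is not identically 0; if there is none, [f] is 0,
    of depth 0 by convention. *)
Lemma quasi_modular_leP k m l f :
  quasi_modular_le C G k m l f <-> exists P, expansion k m l f P.
Proof.
split=> [[l0 l0l [rf [[fs [pfs _ hfs]]|[_ ->]]]]|[P hP]]; last first.
- have [rf sP cP sl] := hP.
  have [ex|nex] := pselect (exists j, (j <= l)%N && `[< (fun z => (P z)`_j) <>
    fun=> 0 >]).
    case: (ex_maxnP ex (fun j => @proj1 _ _ \o elimT andP)).
    move=> l0 /andP[l0l /asboolP nz] mx.
    exists l0 => //; split=> //; left.
    exists (fun (j : 'I_l0.+1) z => (P z)`_j); split=> // g Gg z.
    rewrite sl // (@horner_coef_wide _ l0.+1) //; apply/leq_sizeP => j lj.
    have [jl|jl] := leqP j l; last by rewrite nth_default // (leq_trans (sP z)).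
    apply: contrapT => nj; suff : (j <= l0)%N by rewrite leqNgt lj.
    apply: mx; rewrite jl; apply/asboolP => e; apply: nj.
    by rewrite -[LHS]/((fun z => (P z)`_j) z) e.
  have f0 : f = fun=> 0.
    apply/funext => z; rewrite (expansion_eq z hP); apply: contrapT => nz.
    apply: nex; exists 0%N => //=; apply/asboolP => e; apply: nz.
    by rewrite -[LHS]/((fun z => (P z)`_0) z) e.
  by exists 0%N => //; split=> //; right.
- by exists (fun=> 0); apply: expansion_cst0.
exists (fun z => \poly_(j < l0.+1) fs (inord j) z);
  apply: expansion_widen l0l _.
split=> // [j|g Gg z].
- have [jl|jl] := ltnP j l0.+1.
    rewrite [X in periodic_analytic C X](_ : _ = fs (inord j)) //.
    by apply/funext => z; rewrite coef_poly jl.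
  rewrite [X in periodic_analytic C X](_ : _ = fun=> (0 : C)).
    exact: periodic_cst.
  by apply/funext => z; rewrite coef_poly ltnNge jl.
rewrite hfs // horner_poly; apply: eq_bigr => j _.
by rewrite inord_val.
Qed.

Lemma weakly_modular_le k m f :
  weakly_modular C G k m f <-> quasi_modular_le C G k m 0 f.
Proof.
split=> [h|[l0]]; first by exists 0%N.
by rewrite leqn0 => /eqP ->.
Qed.

Lemma weakly_modularP k m f :
  weakly_modular C G k m f <-> expansion k m 0 f (fun z => (f z)%:P).
Proof.
rewrite weakly_modular_le quasi_modular_leP; split=> [[P hP]|h];
  last by exists (fun z => (f z)%:P).
rewrite (_ : (fun z => (f z)%:P) = P) //; apply/funext => z.
rewrite (expansion_eq z hP); apply/esym/size1_polyC.
by case: hP.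
Qed.

Lemma quasi_modular_le_linear k m l : linear_subspace (quasi_modular_le C G k
  m l).
Proof.
split; first by apply/quasi_modular_leP; exists (fun=> 0);
  apply: expansion_cst0.
move=> a f1 f2 /quasi_modular_leP[P1 h1] /quasi_modular_leP[P2 h2].
by apply/quasi_modular_leP; eexists; apply: expansion_linear h1 h2.
Qed.

Lemma weakly_modular_linear k m : linear_subspace (weakly_modular C G k m).
Proof.
have [h0 h] := quasi_modular_le_linear k m 0.
split; first exact/weakly_modular_le.
by move=> a f1 f2 /weakly_modular_le ? /weakly_modular_le ?;
  apply/weakly_modular_le/h.
Qed.

End Expansions.

(** * The decomposition *)

Section LinearComposition.
Variable L : fieldType.
Implicit Types (p : {poly L}) (x y : L).

Lemma linear_power_coef x y n :
  (size ((x *: 'X + y%:P) ^+ n) <= n.+1)%N /\ ((x *: 'X + y%:P) ^+ n)`_n = x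
    ^+ n.
Proof.
elim: n => [|n [sn cn]]; first by rewrite !expr0 size_poly1 coef1.
rewrite exprS mulrDl -scalerAl mul_polyC; split.
  apply: leq_trans (size_polyD _ _) _; rewrite geq_max; apply/andP; split.
    apply: leq_trans (size_scale_leq _ _) _; rewrite mulrC.
    by apply: leq_trans (size_polyMleq _ _) _; rewrite size_polyX addn2 /= ltnS.
  by apply: leq_trans (size_scale_leq _ _) _; apply: leqW.
rewrite coefD !coefZ coefXM /= cn exprS [X in y * X]nth_default // mulr0.
by rewrite addr0.
Qed.

(** Powers of a linear polynomial below the [n]-th have degree below [n], so only the top term of
    [p] contributes. *)
Lemma comp_linear_coef p x y n : (size p <= n.+1)%N ->
  (p \Po (x *: 'X + y%:P))`_n = p`_n * x ^+ n.
Proof.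
move=> sp; rewrite comp_polyE (big_ord_widen n.+1 (fun j => p`_j *: (x *: 'X +
  y%:P) ^+ j)) //.
rewrite big_mkcond big_ord_recr /= coefD coef_sum big1 ?add0r.
  case: ltnP => [_|h]; first by rewrite coefZ (linear_power_coef x y n).2.
  by rewrite coef0 nth_default ?mul0r.
move=> j _; case: ltnP => // _; last by rewrite coef0.
rewrite coefZ [X in _ * X]nth_default ?mulr0 //.
exact: leq_trans (linear_power_coef x y j).1 (ltn_ord j).
Qed.

End LinearComposition.

(** * Splitting off the leading term, and uniqueness *)

Section Decomposition.
Context (R : realType) (F : finFieldType) (C : Cinfty R F).
Variables (G : set 'M[{poly F}]_2) (hG : GL2_subgroup G).
Hypothesis hcong : exists2 I : set {poly F},
  nonzero_ideal I & principal_congruence I `<=` G.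
Variable w : C.
Hypothesis w0 : w != 0.
Implicit Types (x y : C) (z : Omega C) (f : Omega C -> C).
Implicit Types (g h : 'M[{poly F}]_2) (k m : int) (P : Omega C -> {poly C}).
Local Notation i := (embA C).
Local Notation E := (false_eisenstein w).

(* The cocycle takes infinitely many values: use lower unipotent matrices. *)
Lemma poly_cocycle_eq0 z (Q : {poly C}) (phi : C -> C) : injective phi ->
  (forall g, G g -> Q.[phi (cocycle g z)] = 0) -> Q = 0.
Proof.
move=> phi_inj hQ; have [I [I0 ID IM [x Ix x0]] IG] := hcong.
pose c n : {poly F} := 'X^n * x; pose g n := mx2 1 0 (c n) 1.
have ug n : g n \in unitmx by rewrite unitmxE det2E !mx2E mul0r subr0 mulr1
  unitr1.
have Gg n : G (g n).
  apply: IG; split=> // r s; rewrite [X in _ - X]mxE.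
  case: (ord2P r) => ->; case: (ord2P s) => ->;
    rewrite mx2E /= ?subrr ?subr0 //.
  exact: IM.
(* The value [c/(cz + 1)] determines [c], and ['X^n * x] determines [n]. *)
have cinj : injective (fun n => cocycle (g n) z).
  move=> n n'; rewrite /cocycle.
  have d := den_neq0 z (ug n); have d' := den_neq0 z (ug n').
  move: d d'; rewrite !denE !mx2E rmorph1 => d d' /eqP.
  rewrite eqr_div // !mulrDr !mulr1 !mulrA [i (c n') * _]mulrC => /eqP/addrI.
  move/eqP; rewrite -subr_eq0 -rmorphB embA_eq0 subr_eq0.
  move=> /eqP/(mulIf x0)/(congr1 (fun p : {poly F} => size p)).
  by rewrite !size_polyXn => -[].
apply/eqP; apply: contraT => Q0.
have := @max_poly_roots _ Q [seq phi (cocycle (g n) z) | n <- iota 0 (size Q)]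
  Q0.
rewrite size_map size_iota ltnn => -> //.
  by apply/allP => _ /mapP[n _ ->]; apply/rootP/hQ.
by rewrite map_inj_uniq ?iota_uniq // => n n' /phi_inj/cinj.
Qed.

(** Expanding the slash by [g *m h] in two ways gives an identity at all values of the cocycle of
    [g] at [hz], hence of polynomials: up to the automorphy factor, [P (mob h z)] is [P z] after the
    substitution of [cocycle_mul]. Its slope [det h / (cz + d)^2], to the power [l], shifts weight
    and type in the top coefficient. *)
Lemma leading_coefficient k m l f P : expansion G k m l f P ->
  weakly_modular C G (k - 2 * l%:Z) (m - l%:Z) (fun z => (P z)`_l).
Proof.
move=> [rf sP cP sl]; apply/(weakly_modularP hG); split=> [|z|j|h Gh z].
- by case: (cP l).
- exact: size_polyC_leq1.
- case: j => [|j].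
    rewrite [X in periodic_analytic C X](_ : _ = fun z => (P z)`_l) //.
    by apply/funext => z; rewrite coefC.
  rewrite [X in periodic_analytic C X](_ : _ = fun=> (0 : C)).
    exact: periodic_cst.
  by apply/funext => z; rewrite coefC.
have uh := G_unit hG Gh; have j0 := den_neq0 z uh.
have d0 := det_embA_neq0 C uh.
pose al := i (\det h) / den h z ^+ 2.
have key : (i (\det h) ^ m * den h z ^ (- k)) *: P (mob h z) =
    P z \Po (al *: 'X + (cocycle h z)%:P).
  apply/eqP; rewrite -subr_eq0; apply/eqP.
  apply: (@poly_cocycle_eq0 (mob h z) _ id) => // g Gg.
  have ug := G_unit hG Gg; have Ggh : G (g *m h) by case: hG => _ _ + _; apply.
  rewrite hornerD hornerN hornerZ -sl // -slash_mul // sl // horner_comp.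
  by rewrite hornerD hornerZ hornerX hornerC -cocycle_mul // subrr.
have {key} := congr1 (fun p : {poly C} => p`_l) key.
rewrite coefZ comp_linear_coef // hornerC slashE => key.
rewrite opprD opprK !expfzDr //.
rewrite -[2 * l%:Z]/(2%:Z * l%:Z) -PoszM -!exprnP -exprnN exprM.
rewrite (_ : _ * _ = i (\det h) ^ m * den h z ^ (- k) * (P (mob h z))`_l *
  (i (\det h) ^- l * (den h z ^+ 2) ^+ l)); last by ring.
rewrite key /al expr_div_n -mulrA; apply: etrans (mulr1 _); congr (_ * _).
by rewrite mulrACA divff ?expf_neq0 // mul1r mulVf ?expf_neq0.
Qed.

Lemma eq_expansion k m l f P k' m' f' P' : k = k' -> m = m' ->
  f =1 f' -> P =1 P' -> expansion G k m l f P -> expansion G k' m' l f' P'.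
Proof. by move=> -> -> /funext -> /funext ->. Qed.

Lemma expansion_E : expansion G 2 1 1 E (fun z => (- w^-1) *: 'X + (E z)%:P).
Proof.
split=> [|z|j|g Gg z].
- by case: (periodic_false_eisenstein w).
- by have := (linear_power_coef (- w^-1) (E z) 1).1; rewrite expr1.
- rewrite [X in periodic_analytic C X](_ : _ = fun z =>
    (- w^-1) * (j == 1%N)%:R + E z * (j == 0%N)%:R).
    apply: periodicD; first exact: periodic_cst.
    by apply: periodicM; [apply: periodic_false_eisenstein|apply: periodic_cst].
  by apply/funext => z; rewrite coefD coefZ coefX coefC; case: (j == 0%N);
    rewrite ?mulr1 ?mulr0.
- by rewrite false_eisenstein_slash ?(G_unit hG) // hornerD hornerZ hornerX
  hornerC; ring.
Qed.

Lemma expansion_E_exp n : expansion G (2 * n%:Z) n%:Z n (fun z => E z ^+ n)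
  (fun z => ((- w^-1) *: 'X + (E z)%:P) ^+ n).
Proof.
elim: n => [|n IH].
  split=> [|z|j|g Gg z].
  - exact: rigid_cst.
  - by rewrite expr0 size_poly1.
  - by rewrite [X in periodic_analytic C X](_ : _ = fun=> (1 : {poly C})`_j);
    [apply: periodic_cst|].
  - by rewrite slashE mulr0 oppr0 !expr0z !mul1r !expr0 hornerC.
rewrite -(add1n n); apply: eq_expansion (expansionM hG expansion_E IH) => //.
- by rewrite PoszD; ring.
- by move=> z; rewrite add1n exprS.
- by move=> z; rewrite add1n exprS.
Qed.

Lemma expansion_term k m l n f : (n <= l)%N ->
  weakly_modular C G (k - 2 * n%:Z) (m - n%:Z) f ->
  expansion G k m l (fun z => f z * E z ^+ n)
    (fun z => (f z)%:P * ((- w^-1) *: 'X + (E z)%:P) ^+ n).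
Proof.
move=> nl /(weakly_modularP hG) hf;
  have := expansionM hG hf (expansion_E_exp n).
by rewrite !subrK add0n; apply: expansion_widen.
Qed.

Lemma expansion_sum k m l (g : nat -> Omega C -> C) n : (n <= l.+1)%N ->
  (forall j, (j < n)%N -> weakly_modular C G (k - 2 * j%:Z) (m - j%:Z) (g j)) ->
  expansion G k m l (fun z => \sum_(j < n) g j z * E z ^+ j)
    (fun z => \sum_(j < n) (g j z)%:P * ((- w^-1) *: 'X + (E z)%:P) ^+ j).
Proof.
elim: n => [|n IH] nl hg.
  by apply: eq_expansion (expansion_cst0 C G k m l) => // z; rewrite big_ord0.
have h1 := expansion_term (n := n) nl (hg n (ltnSn n)).
have h2 := IH (ltnW nl) (fun j jn => hg j (leqW jn)).
apply: eq_expansion (expansion_linear 1 h2 h1) => // z; rewrite big_ord_recr /=.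
  by rewrite mul1r.
by rewrite scale1r.
Qed.

Lemma expansion_lower k m l f P : expansion G k m l.+1 f P ->
  (forall z, (P z)`_l.+1 = 0) -> expansion G k m l f P.
Proof.
move=> [rf sP cP sl] P0; split=> // z; apply/leq_sizeP => j.
rewrite leq_eqVlt => /orP[/eqP <-//|lj].
by rewrite nth_default // (leq_trans (sP z)).
Qed.

Lemma decomposition_exists k m l f P : expansion G k m l f P ->
  exists g : nat -> Omega C -> C,
    (forall j, (j <= l)%N -> weakly_modular C G (k - 2 * j%:Z) (m - j%:Z) (g
      j)) /\
    forall z, f z = \sum_(j < l.+1) g j z * E z ^+ j.
Proof.
elim: l f P => [|l IH] f P hP.
  exists (fun=> f); split=> [j|z];
    last by rewrite big_ord_recl big_ord0 expr0 mulr1 addr0.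
  rewrite leqn0 => /eqP ->; rewrite mulr0 !subr0.
  by apply/weakly_modular_le/(quasi_modular_leP hG); exists P.
have hlead := leading_coefficient hP.
(* The top coefficient of the expansion of [E ^+ l.+1] is [(- w^-1) ^+ l.+1], so adding [x] times
   the leading coefficient times this power to [f] removes the term of degree [l.+1]. *)
pose x := - (- w) ^+ l.+1.
have ht := expansion_linear x (expansion_term (leqnn _) hlead) hP.
have low := expansion_lower ht; rewrite /= in low.
have [z|g [hg fg]] := IH _ _ (low _).
  rewrite coefD coefZ coefCM (linear_power_coef _ _ _).2 mulrCA.
  by rewrite /x mulNr -exprMn mulrNN divff // expr1n mulrN1 addNr.
exists (fun j => if j == l.+1 then (fun z => - x * (P z)`_l.+1) else g j);
  split.
  move=> j; rewrite leq_eqVlt; case: eqP => [-> _|_ jl]; last exact: hg.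
  have [W0 Wlin] := weakly_modular_linear C hG (k - 2 * l.+1%:Z) (m - l.+1%:Z).
  have := Wlin (- x) _ _ hlead W0.
  by congr (weakly_modular _ _ _ _ _); apply/funext => z; rewrite addr0.
move=> z; rewrite big_ord_recr /= eqxx.
rewrite (eq_bigr (fun j : 'I_l.+1 => g j z * E z ^+ j)) => [|j _];
  last by rewrite ltn_eqF.
by rewrite -fg; ring.
Qed.

(** Slashing the relation by [h] replaces E by [E - w^-1 X] and leaves the values [g j z] unchanged.
    The polynomial with these coefficients thus vanishes at all values of [E z - w^-1 X], so it is
    0. *)
Lemma decomposition_unique k m l (g : nat -> Omega C -> C) :
  (forall j, (j <= l)%N -> weakly_modular C G (k - 2 * j%:Z) (m - j%:Z) (g j))
    ->
  (forall z, \sum_(j < l.+1) g j z * E z ^+ j = 0) ->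
  forall j, (j <= l)%N -> g j = fun=> 0.
Proof.
move=> hg h0 j jl; apply/funext => z.
have [_ _ _ sl] := expansion_sum (leqnn l.+1) hg.
pose Q := \poly_(j < l.+1) g j z.
suff Q0 : Q = 0 by have := congr1 (fun p : {poly C} => p`_j) Q0;
  rewrite coef_poly ltnS jl coef0.
apply: (@poly_cocycle_eq0 z _ (fun y => - w^-1 * y + E z)) => [y y'|h Gh].
  by move/addIr/mulfI; apply; rewrite oppr_eq0 invr_eq0.
have e := sl h Gh z; rewrite slashE h0 mulr0 in e.
rewrite /Q horner_poly [RHS]e horner_sum.
by apply: eq_bigr => n _;
  rewrite hornerM hornerC horner_exp hornerD hornerZ hornerX hornerC.
Qed.

End Decomposition.

(** * The direct sum, for families indexed by ['I_l.+1] *)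

Theorem theorem3p2 (R : realType) (F : finFieldType) (C : Cinfty R F)
    (w : C) (hw : carlitz_period w)
    (G : set 'M[{poly F}]_2) (hG : GL2_subgroup G)
    (hcong : exists2 I : set {poly F},
       nonzero_ideal I & principal_congruence I `<=` G)
    (k l : nat) (m : int) :
  let V := quasi_modular_le C G k%:Z m l in
  let W (i : 'I_l.+1) :=
    weakly_modular C G (k%:Z - 2 * i%:Z) (m - i%:Z) in
  let S (g : 'I_l.+1 -> Omega C -> C) : Omega C -> C :=
    fun z => \sum_(i < l.+1) g i z * false_eisenstein w z ^+ i in
  [/\ linear_subspace V,
      forall i, linear_subspace (W i),
      forall g, (forall i, W i (g i)) -> V (S g) &
      forall f, V f ->
        exists! g : 'I_l.+1 -> Omega C -> C,
          (forall i, W i (g i)) /\ f = S g].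
Proof.
move=> V W S; have [w0 _] := hw.
(* The preceding lemmas index coefficients by natural numbers; [inord] extends a family on ['I_l.+1]
   to them. *)
have inordW (g : 'I_l.+1 -> Omega C -> C) : (forall i, W i (g i)) ->
    forall j, (j <= l)%N ->
    weakly_modular C G (k%:Z - 2 * j%:Z) (m - j%:Z) (g (inord j)).
  by move=> hg j jl; have := hg (inord j); rewrite /W inordK.
have inordS (g : 'I_l.+1 -> Omega C -> C) z :
    S g z = \sum_(j < l.+1) g (inord j) z * false_eisenstein w z ^+ j.
  by apply: eq_bigr => j _; rewrite inord_val.
split.
- exact: quasi_modular_le_linear.
- by move=> i; apply: weakly_modular_linear.
- move=> g /inordW hg; apply/(quasi_modular_leP hG); eexists.
  rewrite (_ : S g = fun z => \sum_(j < l.+1) g (inord j) z * false_eisenstein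
    w z ^+ j).
    exact: (expansion_sum (g := fun j => g (inord j)) hG w (leqnn l.+1) hg).
  by apply/funext => z; apply: inordS.
move=> f /(quasi_modular_leP hG)[P hP].
have [g [hg fg]] := decomposition_exists hG hcong w0 hP.
exists (fun i : 'I_l.+1 => g i); split.
  by split=> [i|]; [apply: hg; rewrite -ltnS|apply/funext => z; apply: fg].
move=> g' [hg' fg']; apply/funext => i.
(* The difference of the two families is a decomposition of 0. *)
have Wd j : (j <= l)%N -> weakly_modular C G (k%:Z - 2 * j%:Z) (m - j%:Z)
    (fun z => -1 * g' (inord j) z + g j z).
  move=> jl; apply: (weakly_modular_linear C hG _ _).2; last exact: hg.
  exact: inordW.
have Sd z : \sum_(j < l.+1) (-1 * g' (inord j) z + g j z) *
    false_eisenstein w z ^+ j = 0.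
  rewrite (eq_bigr (fun j : 'I_l.+1 => g j z * false_eisenstein w z ^+ j -
    g' (inord j) z * false_eisenstein w z ^+ j)); last by move=> j _; ring.
  by rewrite sumrB -fg -inordS fg' subrr.
have il : (i <= l)%N by rewrite -ltnS.
have d0 := decomposition_unique hG hcong w0 Wd Sd il.
apply/funext => z; have := congr1 (fun h => h z) d0.
by rewrite /= inord_val mulN1r addrC => /eqP; rewrite subr_eq0 => /eqP.
Qed.
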